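(* Let $g\in C^3[0,1]$ be strictly increasing and strictly convex with $g(0)=0$ and curvature bounded below by a positive constant, let $\gamma$ be its graph, and let $Q_z^\gamma$ be the measure on the space $\Pi$ of convex lattice polygonal lines defined in the context. Then for any $\varepsilon>0$, $$\lim_{n\to\infty}Q_z^\gamma\{\varGamma\in\Pi:\ d_{\mathcal L}(n_1^{-1}\varGamma,\gamma)\le\varepsilon\}=1 .$$
   Context: Curve. $\gamma$ is the graph of $g:[0,1]\to\mathbb{R}$, and curvature bounded below means $\inf_{u\in[0,1]}g''(u)(1+g'(u)^2)^{-3/2}\ge K_0>0$. Put $c_\gamma=g(1)$, $t_0=g'(0)$, $t_1=g'(1)$. For $0\le t\le\infty$ let $u_\gamma(t)=0$ if $t\le t_0$, $u_\gamma(t)=(g')^{-1}(t)$ if $t_0\le t\le t_1$, $u_\gamma(t)=1$ if $t\ge t_1$, and let $\ell_\gamma(t)=\int_0^{u_\gamma(t)}\sqrt{1+g'(u)^2}\,du$ be the length of the part of $\gamma$ with tangent slope at most $t$. For $t_0\le t\le t_1$ put $\varkappa_\gamma(t)=g''(u_\gamma(t))(1+t^2)^{-3/2}$. Parameters. Let $\kappa=(2\zeta(3)/\zeta(2))^{1/3}$ ($\zeta$ the Riemann zeta function), and $\delta_1(t)=\kappa\,\varkappa_\gamma(t)^{1/3}\frac{c_\gamma\sqrt{1+t^2}}{c_\gamma+t}$, $\delta_2(t)=\delta_1(t)/c_\gamma$ for $t_0\le t\le t_1$, and $\delta_1(t)=\delta_2(t)=+\infty$ for $t\in[0,\infty]\setminus[t_0,t_1]$.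 Let $\mathcal X=\{x=(x_1,x_2)\in\mathbb{Z}_+^2:\gcd(x_1,x_2)=1\}$ (so $(1,0),(0,1)\in\mathcal X$), and $\tau(x)=x_2/x_1\in[0,\infty]$. For $n=(n_1,n_2)$ with $n_1,n_2\ge1$ put $\rho_n=c_\gamma n_1/n_2$, $\alpha_n=(\rho_n n_1)^{-1/3}$, and for $x\in\mathcal X$ put $\tilde x=(x_1,\rho_n x_2)$, $z_1(x)=e^{-\alpha_n\delta_1(\tau(\tilde x))}$, $z_2(x)=e^{-\alpha_n\rho_n\delta_2(\tau(\tilde x))}$ (with $e^{-\infty}=0$), and $z^x=z_1(x)^{x_1}z_2(x)^{x_2}$ (with $0^0=1$). Measure. $Q_z^\gamma$ (depending on $n$) is the probability law under which $\{\nu(x)\}_{x\in\mathcal X}$ are independent with $Q_z^\gamma\{\nu(x)=k\}=z^{kx}(1-z^x)$, $k\in\mathbb{Z}_+$, where $z^{kx}=(z^x)^k$; almost surely only finitely many $\nu(x)$ are nonzero. A finitely supported $\nu$ is identified with the convex lattice polygonal line $\varGamma$ starting at the origin with edges $x\nu(x)$ ($\nu(x)>0$) arranged in order of increasing slope; $\Pi$ is the set of all such lines. Metric. For $\varGamma\in\Pi$ let $\ell_\varGamma(t)=\sum_{x\in\mathcal X,\ \tau(x)\le t}|x|\,\nu(x)$ be the length of the part of $\varGamma$ with edge slopes at most $t$; the line $n_1^{-1}\varGamma$ has length function $n_1^{-1}\ell_\varGamma$. Define $d_{\mathcal L}(\gamma_1,\gamma_2)=\sup_{0\le t\le\infty}|\ell_{\gamma_1}(t)-\ell_{\gamma_2}(t)|$.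 Limit. ''$n\to\infty$'' means $n_1,n_2\to\infty$ with $n_2/n_1\to c_\gamma$. *)

(* Defs.v *)
From HB Require Import structures.
From mathcomp Require Import all_boot all_order all_algebra.
From mathcomp Require Import all_classical all_reals all_analysis.
Set Implicit Arguments.
Unset Strict Implicit.
Unset Printing Implicit Defensive.
Import Order.TTheory GRing.Theory Num.Theory.
Import numFieldNormedType.Exports.
Local Open Scope classical_set_scope.
Local Open Scope ring_scope.

(* Derivatives of functions on [0, 1].  Everything is taken relative to the   *)
(* interval (one-sided at 0 and 1), so the values of f outside [0, 1] play no *)
(* role; outside [0, 1] the value of derI is unspecified.                     *)
Section calculus_on_unit_interval.
Variable R : realType.
Implicit Types (f g : R -> R) (x y : R) (k : nat).

Definition diffq f x y : R := (f y - f x) / (y - x).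

Definition derivableI f x : Prop :=
  cvg (diffq f x y @[y --> within (`[0, 1] : set R) x^']).

Definition derI f x : R :=
  lim (diffq f x y @[y --> within (`[0, 1] : set R) x^']).

Definition CkI k f : Prop :=
  (forall j, (j < k)%N ->
    forall x, x \in `[0, 1] -> derivableI (iter j derI f) x) /\
  {within `[0, 1], continuous (iter k derI f)}.

Definition strictly_increasingI f : Prop :=
  {in `[0, 1] &, {homo f : x y / x < y}}.

Definition strictly_convexI f : Prop :=
  {in `[0, 1] &, forall x y, x != y -> forall s, 0 < s -> s < 1 ->
    f (s * x + (1 - s) * y) < s * f x + (1 - s) * f y}.

Definition curvature_bounded_below g : Prop :=
  exists2 K0 : R, 0 < K0 &
    {in `[0, 1], forall u,
       K0 <= derI (derI g) u * (1 + derI g u ^+ 2) `^ (- (3 / 2))}.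

End calculus_on_unit_interval.

Section curve.
Variables (R : realType) (g : R -> R).
Implicit Type t : \bar R.

Definition c_gamma : R := g 1.
Definition slope0 : R := derI g 0.
Definition slope1 : R := derI g 1.

(* [fun=> 0] is the value of the partial inverse off the range of g'; it is   *)
(* irrelevant for slopes in [slope0, slope1].                                 *)
Definition u_gamma t : R :=
  if (t <= slope0%:E)%E then 0
  else if (slope1%:E <= t)%E then 1
  else 'pinv_(fun=> 0) `[0, 1] (derI g) (fine t).

Definition len_gamma t : R :=
  (\int[lebesgue_measure]_(u in `[0%R, u_gamma t])
     Num.sqrt (1 + derI g u ^+ 2))%R.

Definition curv_gamma (t : R) : R :=
  derI (derI g) (u_gamma t%:E) * (1 + t ^+ 2) `^ (- (3 / 2)).

End curve.

Section parameters.
Variable R : realType.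

Definition zeta (s : nat) : R :=
  limn (series (fun k : nat => (k.+1%:R ^+ s)^-1 : R)).

Definition kappa : R := (2 * zeta 3 / zeta 2) `^ (1 / 3).

Variable g : R -> R.

Definition delta1_fin (t : R) : R :=
  kappa * curv_gamma g t `^ (1 / 3)
  * ((c_gamma g * Num.sqrt (1 + t ^+ 2)) / (c_gamma g + t)).

Definition delta1 (t : \bar R) : \bar R :=
  if ((slope0 g)%:E <= t <= (slope1 g)%:E)%E
  then (delta1_fin (fine t))%:E else +oo%E.

Definition delta2 (t : \bar R) : \bar R :=
  if ((slope0 g)%:E <= t <= (slope1 g)%:E)%E
  then (delta1_fin (fine t) / c_gamma g)%:E else +oo%E.

End parameters.

Definition direction := {x : nat * nat | coprime x.1 x.2}.

Section directions.
Variable R : realType.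

Definition dir1 (x : direction) : nat := (val x).1.
Definition dir2 (x : direction) : nat := (val x).2.

Definition slope (a b : R) : \bar R :=
  if a == 0 then +oo%E else (b / a)%:E.

Definition tau (x : direction) : \bar R := slope (dir1 x)%:R (dir2 x)%:R.

Definition enorm (x : direction) : R :=
  Num.sqrt ((dir1 x)%:R ^+ 2 + (dir2 x)%:R ^+ 2).

Variables (g : R -> R) (n : nat * nat).

Definition rho : R := c_gamma g * n.1%:R / n.2%:R.
Definition alpha : R := (rho * n.1%:R) `^ (- (1 / 3)).

Definition tau_tilde (x : direction) : \bar R :=
  slope (dir1 x)%:R (rho * (dir2 x)%:R).

Definition z1 (x : direction) : R :=
  fine (expeR (- (alpha%:E * delta1 g (tau_tilde x))))%E.

Definition z2 (x : direction) : R :=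
  fine (expeR (- ((alpha * rho)%:E * delta2 g (tau_tilde x))))%E.

Definition zpow (x : direction) : R := z1 x ^+ dir1 x * z2 x ^+ dir2 x.

End directions.

(* All families (nu(x))_x, with the product sigma-algebra.                    *)
Definition cylinders : set (set (direction -> nat)) :=
  [set A | exists x (B : set nat), A = [set nu | B (nu x)]].

Definition config := g_sigma_algebraType cylinders.

Definition mutually_independent (d d' : measure_display) (R : realType)
    (T : measurableType d) (T' : measurableType d') (P : probability T R)
    (I : choiceType) (X : I -> T -> T') : Prop :=
  forall (s : seq I) (B : I -> set T'), uniq s ->
    (forall i, i \in s -> measurable (B i)) ->
    (P (\bigcap_(i in [set` s]) (X i @^-1` B i))
     = \prod_(i <- s) P (X i @^-1` B i))%E.

(* This characterizes Q uniquely: it is the product over x of the geometric   *)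
(* laws with parameters z^x.                                                  *)
Definition is_Qz (R : realType) (g : R -> R) (n : nat * nat)
    (Q : probability config R) : Prop :=
  mutually_independent Q (fun (x : direction) (nu : config) => nu x) /\
  forall (x : direction) (k : nat),
    Q [set nu | nu x = k] = (zpow g n x ^+ k * (1 - zpow g n x))%:E.

(* A convex lattice polygonal line is identified with the finitely supported  *)
(* family of the multiplicities of its primitive edge directions.             *)
Definition Pi : set config := [set nu | finite_set [set x | nu x != 0%N]].

Section metric.
Variable R : realType.

(* Finitely supported sum; only meaningful for nu in Pi.                      *)
Definition len_line (nu : config) (t : \bar R) : R :=
  \sum_(x \in [set x | (tau R x <= t)%E]) (enorm R x * (nu x)%:R).

(* The distance d_L of two curves, given by their length functions.           *)
Definition dL (l1 l2 : \bar R -> R) : \bar R :=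
  ereal_sup [set `|l1 t - l2 t|%:E | t in [set t : \bar R | (0 <= t)%E]].

(* The filter n1 -> oo, n2 -> oo, n2 / n1 -> c.                               *)
Definition n_infty (c : R) : set_system (nat * nat) :=
  [set A | exists (N : nat) (e : R), 0 < e /\
     forall n : nat * nat, (N <= n.1)%N -> (N <= n.2)%N ->
       `|n.2%:R / n.1%:R - c| < e -> A n].

Global Instance n_infty_filter (c : R) : Filter (n_infty c).
Proof.
split.
- by exists 0%N, 1; split.
- move=> A B [N [e [e0 HA]]] [M [f [f0 HB]]].
  exists (maxn N M), (Num.min e f); split; first by rewrite lt_min e0.
  move=> n; rewrite !geq_max lt_min => /andP[N1 M1] /andP[N2 M2] /andP[He Hf].
  by split; [exact: HA|exact: HB].
- move=> A B AB [N [e [e0 HA]]]; exists N, e; split=> // n N1 N2 ne.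
  by apply: AB; exact: HA.
Qed.

End metric.

(* Main.v *)
Require Import Defs.
From mathcomp Require Import all_boot all_order all_algebra.
From mathcomp Require Import all_classical all_reals all_analysis.
From mathcomp Require Import measurable_realfun ring lra.
Set Implicit Arguments.
Unset Strict Implicit.
Unset Printing Implicit Defensive.
Import Order.TTheory GRing.Theory Num.Theory.
Import numFieldNormedType.Exports.
Local Open Scope classical_set_scope.
Local Open Scope ring_scope.

(* The factors z_1, z_2 combine into z^x = exp (- alpha kappa g''(u)^(1/3) x_1),
   where u is the abscissa of the point of the curve with slope tau(x~).  On a
   narrow cone of slopes g''(u) is nearly constant, so the mean length of the
   edges with slopes in the cone reduces to
     W(h) = sum x_1 / (exp (h x_1) - 1)   (x primitive in the cone)
          = sum_k P(k h),   P(h) = sum x_1 exp (- h x_1)   (x primitive in the cone).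
   The sum over all the lattice points of the cone is both an elementary power
   series, ~ 2 lambda h^-3 with lambda the length of the interval of slopes, and
   the sum over k of k P(k h).  Since zeta(2) - 1 < 1 the latter relation is
   inverted by a contraction argument: h^3 P(h) -> 2 lambda / zeta(2), hence
   h^3 W(h) -> 2 lambda zeta(3) / zeta(2) = kappa^3 lambda, uniformly in the cone.
   Summed over the cones cut by a subdivision of [0, 1], this yields Riemann sums
   of the length of the curve.  The variance of the length of the line in a cone
   is of order n_1^(4/3), so Chebyshev's inequality gives convergence in each of
   the finitely many cones; monotonicity of the length functions in the slope
   then makes it uniform.  The event is measurable because Pi is countable. *)

(** * Power series and zeta values *)

(** Expanding over the multiplier k, instead of inverting by the Moebius function, keeps every
    infinite series nonnegative. The price: the error at scale h depends on the errors at 2h, 3h,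
    ..., most of which are not small scales, so a bound on h^3 P(h) valid for every h > 0 is needed
    as well. The cones move with n through [rho g n], so a limit for one fixed cone would not do:
    [is_sector] keeps only dilation invariance and the count of points in each column, and the
    estimates are uniform over sectors of bounded [lam]. Two mismatches remain. The line is cut at
    tau(x) but the cones at tau(x~) = rho tau(x), so a cut need not respect the cones; up to three
    of them are only estimated from both sides. And a cone holds infinitely many directions, so
    Chebyshev's inequality is applied on a finite set F; outside F all multiplicities vanish with
    high probability, because Q(nu(x) > 0) = z^x is at most the mean length contributed by x. *)

Section sums.
Variable R : realType.

(** The inequality [<=] for every factor is enough: applied to [c^-1] and the terms [c * a i] it
    yields the converse. *)
Lemma esumZl (T : choiceType) (S : set T) (a : T -> \bar R) (c : R) :
  0 <= c -> (forall i, S i -> (0 <= a i)%E) ->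
  (\esum_(i in S) (c%:E * a i) = c%:E * \esum_(i in S) a i)%E.
Proof.
move=> c0 a0.
have le_Z (d : R) (b : T -> \bar R) : 0 <= d ->
    (forall i, S i -> (0 <= b i)%E) ->
    (\esum_(i in S) (d%:E * b i) <= d%:E * \esum_(i in S) b i)%E.
  move=> d0 b0; apply: ge_ereal_sup => _ [X [finX XS] <-].
  rewrite fsbig_finite//= big_seq -ge0_sume_distrr; last first.
    by move=> i; rewrite in_fset_set// inE => /XS/b0.
  rewrite lee_wpmul2l ?lee_fin// -big_seq; apply: ereal_sup_ubound.
  by exists X => //; rewrite fsbig_finite.
apply/eqP; rewrite eq_le le_Z//=.
have [->|cn0] := eqVneq c 0.
  by rewrite mul0e esum_ge0// => i _; rewrite mul0e.
have cgt : 0 < c by rewrite lt_neqAle eq_sym cn0.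
have := le_Z c^-1 (fun i => c%:E * a i)%E.
rewrite invr_ge0 c0 => /(_ isT)-/(_ _)/wrap[i Si|].
  by rewrite mule_ge0 ?lee_fin// a0.
rewrite (@eq_esum _ _ _ _ a); last first.
  by move=> i _; rewrite muleA -EFinM mulVf// mul1e.
by rewrite lee_pdivlMl.
Qed.

Lemma exchange_esum (T1 T2 : choiceType) (S1 : set T1) (S2 : set T2)
    (a : T1 -> T2 -> \bar R) : (forall i j, S1 i -> S2 j -> (0 <= a i j)%E) ->
  (\esum_(i in S1) \esum_(j in S2) a i j =
   \esum_(j in S2) \esum_(i in S1) a i j)%E.
Proof.
move=> a0; rewrite !esum_esum//; last by move=> i j Si Sj; exact: a0.
rewrite (reindex_esum (S1 `*`` (fun=> S2)) _ (fun x => (x.2, x.1)))//.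
split => [[i j] []//|[i j] [i' j'] _ _ [-> ->]//|[i j] [/= ? ?]].
by exists (j, i).
Qed.

Lemma esum_nat_fin_ub (v : nat -> R) (B : R) : (forall k, 0 <= v k) ->
  (forall n, \sum_(k < n) v k <= B) ->
  (\esum_(k in setT) (v k)%:E <= B%:E)%E.
Proof.
move=> v0 vB; rewrite -nneseries_esumT; last by move=> k; rewrite lee_fin.
apply: lime_le; first by apply: is_cvg_nneseries => k _ _; rewrite lee_fin.
by apply: nearW => n; rewrite sumEFin lee_fin big_mkord.
Qed.

Lemma ge_esum_nat (v : nat -> R) (V : R) n : (forall k, 0 <= v k) ->
  (\esum_(k in setT) (v k)%:E = V%:E)%E -> \sum_(k < n) v k <= V.
Proof.
move=> v0; rewrite -nneseries_esumT; last by move=> k; rewrite lee_fin.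
move=> vV; rewrite -lee_fin -vV -sumEFin -(big_mkord xpredT (EFin \o v)).
by apply: nneseries_lim_ge => k _; rewrite lee_fin.
Qed.

Lemma sum_inv_sqr_tail n m : (0 < n)%N ->
  \sum_(n <= k < n + m) (k.+1%:R ^+ 2)^-1 <= n%:R^-1 - (n + m)%:R^-1 :> R.
Proof.
move=> n0; elim: m => [|m IH]; first by rewrite addn0 big_geq// subrr.
rewrite addnS big_nat_recr ?leq_addr//=.
have key (x : R) : 0 < x -> ((x + 1) ^+ 2)^-1 <= x^-1 - (x + 1)^-1.
  move=> x0; have x1 : 0 < x + 1 by rewrite addr_gt0.
  rewrite -subr_ge0 (_ : _ - _ = (x * (x + 1) ^+ 2)^-1).
    by rewrite invr_ge0 mulr_ge0 ?sqr_ge0// ltW.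
  by field; rewrite !lt0r_neq0.
have := key (n + m)%:R; rewrite ltr0n addn_gt0 n0 natr1 => /(_ isT) k1.
by rewrite (le_trans (lerD IH k1))// subrKA.
Qed.

(** Domination by B / k^2, whose tail telescopes to at most B / n, gives an explicit truncation
    error; it serves both the zeta values and the sums over scales. *)
Lemma esum_nat_tail (v : nat -> R) (V B : R) n : (0 < n)%N ->
  (forall k, 0 <= v k) -> (forall k, v k <= B / k.+1%:R ^+ 2) ->
  (\esum_(k in setT) (v k)%:E = V%:E)%E -> V <= \sum_(k < n) v k + B / n%:R.
Proof.
move=> n0 v0 vB vV; rewrite -lee_fin -vV; apply: esum_nat_fin_ub => // m.
have B0 : 0 <= B by have := le_trans (v0 0%N) (vB 0%N); rewrite expr1n divr1.
apply: (@le_trans _ _ (\sum_(k < n + m) v k)).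
  by rewrite addnC big_split_ord/= lerDl sumr_ge0.
rewrite big_split_ord/= lerD2l.
apply: (@le_trans _ _ (B * \sum_(n <= k < n + m) (k.+1%:R ^+ 2)^-1)).
  rewrite mulr_sumr -{2}(add0n n) big_addn addKn big_mkord.
  by apply: ler_sum => i _; rewrite addnC vB.
rewrite ler_wpM2l//; apply: le_trans (sum_inv_sqr_tail _ n0) _.
by rewrite gerBl invr_ge0.
Qed.

Lemma zeta_esum s : (2 <= s)%N ->
  (\esum_(k in setT) ((k.+1%:R ^+ s)^-1)%:E = (zeta R s)%:E)%E.
Proof.
move=> s2; have v0 k : 0 <= (k.+1%:R ^+ s)^-1 :> R.
  by rewrite invr_ge0 exprn_ge0.
rewrite -nneseries_esumT; last by move=> k; rewrite lee_fin.
have vle (k : nat) : (k.+1%:R ^+ s)^-1 <= (k.+1%:R ^+ 2)^-1 :> R.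
  by rewrite lef_pV2 ?posrE ?exprn_gt0// ler_weXn2l// ler1n.
have cv : cvgn (series (fun k : nat => (k.+1%:R ^+ s)^-1 : R)).
  apply: nondecreasing_is_cvgn.
    by apply/nondecreasing_seqP => n; rewrite seriesSr lerDl.
  exists 2 => _ [[|n] _ <-]; first by rewrite /series/= big_geq.
  rewrite /series/= big_nat_recl// expr1n invr1 -[leRHS]/(1 + 1) lerD2l.
  apply: (@le_trans _ _ (\sum_(1 <= k < 1 + n) (k.+1%:R ^+ 2)^-1)).
    rewrite -{1}(add0n 1%N) big_addn addKn; by apply: ler_sum => i _; rewrite addn1.
  apply: le_trans (sum_inv_sqr_tail _ _) _ => //.
  by rewrite invr1 gerBl invr_ge0.
rewrite /zeta -EFin_lim//; congr (limn _); apply/funext => n /=.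
by rewrite /series/= sumEFin.
Qed.

Lemma zeta_sum_le s n : (2 <= s)%N ->
  \sum_(k < n) (k.+1%:R ^+ s)^-1 <= zeta R s.
Proof. by move=> s2; apply: ge_esum_nat (zeta_esum s2). Qed.

Lemma zeta_tail s n : (2 <= s)%N -> (0 < n)%N ->
  zeta R s <= \sum_(k < n) (k.+1%:R ^+ s)^-1 + n%:R^-1.
Proof.
move=> s2 n0; have := esum_nat_tail n0 _ _ (zeta_esum s2).
move=> /(_ 1); rewrite div1r; apply => k; first by rewrite invr_ge0 exprn_ge0.
rewrite [leRHS]div1r lef_pV2 ?posrE ?exprn_gt0//.
by rewrite ler_weXn2l// ler1n.
Qed.

Lemma zeta_ge1 s : (2 <= s)%N -> 1 <= zeta R s.
Proof.
by move=> /(zeta_sum_le 1); rewrite big_ord1 expr1n invr1.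
Qed.

(** Two terms and the tail bound: 1 + 1/4 + 1/2. This makes the contraction factor zeta(2) - 1 at
    most 3/4. *)
Lemma zeta2_le : zeta R 2 <= 7 / 4.
Proof.
have := @zeta_tail 2 2 isT isT; rewrite 2!big_ord_recr big_ord0/= add0r expr1n.
lra.
Qed.

Lemma kappa_gt0 : 0 < kappa R.
Proof.
rewrite powR_gt0// divr_gt0 ?mulr_gt0//.
  by rewrite (lt_le_trans ltr01)// zeta_ge1.
by rewrite (lt_le_trans ltr01)// zeta_ge1.
Qed.

Lemma kappa3 : kappa R ^+ 3 = 2 * zeta R 3 / zeta R 2.
Proof.
have z0 : 0 <= 2 * zeta R 3 / zeta R 2.
  by rewrite divr_ge0 ?mulr_ge0// (le_trans ler01)// zeta_ge1.
by rewrite -powR_mulrn ?powR_ge0// -powRrM div1r mulVf// powRr1.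
Qed.

Lemma esum_geom (u : R) : 0 <= u < 1 ->
  (\esum_(k in setT) (u ^+ k)%:E = ((1 - u)^-1)%:E)%E.
Proof.
move=> /andP[u0 u1]; rewrite -nneseries_esumT; last first.
  by move=> k; rewrite lee_fin exprn_ge0.
have /(_ _)/wrap[|cv] := @cvg_geometric_series R 1 u.
  by rewrite ger0_norm.
rewrite mul1r in cv; rewrite -[X in X%:E](cvg_lim _ cv)//.
rewrite -EFin_lim; last exact: cvgP cv.
congr (limn _); apply/funext => n /=.
by rewrite sumEFin /series/=; under [in RHS]eq_bigr do rewrite mul1r.
Qed.

Lemma esum_nat_recl (f : nat -> \bar R) : (forall k, (0 <= f k)%E) ->
  (\esum_(k in setT) f k = f 0%N + \esum_(k in setT) f k.+1)%E.
Proof.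
move=> f0; rewrite -!nneseries_esumT// nneseries_recl//; congr (_ + _)%E.
rewrite -(nneseries_addn _ f0); apply: eq_eseriesr => k _.
by rewrite addn1.
Qed.

(** Summation by parts for generating functions: C = u (C + D), whence C = u D / (1 - u). The
    equation by itself does not rule out C = +oo, so the partial sums are bounded beforehand.
    Differences 1 and 2k + 1 give the series of k u^k and k^2 u^k. *)
Lemma esum_geom_primitive (c d : nat -> R) (u D : R) : 0 <= u < 1 ->
  c 0%N = 0 -> (forall k, c k.+1 = c k + d k) -> (forall k, 0 <= d k) ->
  (\esum_(k in setT) (d k * u ^+ k)%:E = D%:E)%E ->
  (\esum_(k in setT) (c k * u ^+ k)%:E = (u * D / (1 - u))%:E)%E.
Proof.
move=> /andP[u0 u1] c0 cS d0 dD.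
have cge0 k : 0 <= c k by elim: k => [|k IH]; rewrite ?c0// cS addr_ge0.
have du k : 0 <= d k * u ^+ k by rewrite mulr_ge0 ?exprn_ge0.
have cu k : 0 <= c k * u ^+ k by rewrite mulr_ge0 ?exprn_ge0.
have u1' : 0 < 1 - u by rewrite subr_gt0.
have fin : (\esum_(k in setT) (c k * u ^+ k)%:E <= (u * D / (1 - u))%:E)%E.
  apply: esum_nat_fin_ub => // n; rewrite ler_pdivlMr//.
  have h1 : \sum_(k < n) c k * u ^+ k + c n * u ^+ n =
      u * (\sum_(k < n) c k * u ^+ k + \sum_(k < n) d k * u ^+ k).
    rewrite -(big_ord_recr n (fun k => c k * u ^+ k))/= big_ord_recl/= c0 mul0r add0r -big_split/=.
    by rewrite mulr_sumr; apply: eq_bigr => i _; rewrite cS exprS; ring.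
  have h2 : u * \sum_(k < n) d k * u ^+ k <= u * D.
    by rewrite ler_wpM2l//; apply: ge_esum_nat dD.
  rewrite mulrDr in h1; have := cu n; lra.
have [C CE] : exists C : R, (\esum_(k in setT) (c k * u ^+ k)%:E = C%:E)%E.
  exists (fine (\esum_(k in setT) (c k * u ^+ k)%:E)); rewrite fineK//.
  rewrite ge0_fin_numE; first exact: le_lt_trans fin (ltry _).
  by apply: esum_ge0 => k _; rewrite lee_fin.
have := @esum_nat_recl (fun k => (c k * u ^+ k)%:E).
rewrite c0 mul0r add0e => /(_ _)/wrap[k|]; first by rewrite lee_fin.
rewrite (@eq_esum _ _ _ (fun k => (c k.+1 * u ^+ k.+1)%:E)
   (fun k => (u%:E * ((c k * u ^+ k)%:E + (d k * u ^+ k)%:E))%E)); last first.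
  by move=> k _; rewrite cS exprS -EFinD -EFinM; congr EFin; ring.
rewrite esumZl//; last by move=> k _; rewrite adde_ge0// lee_fin.
rewrite esumD; try by move=> k _; rewrite lee_fin.
rewrite CE dD -EFinD -EFinM => -[CC].
by congr EFin; apply: (mulIf (lt0r_neq0 u1')); rewrite mulfVK ?lt0r_neq0//; lra.
Qed.

Lemma esum_geom1 (u : R) : 0 <= u < 1 ->
  (\esum_(k in setT) (k%:R * u ^+ k)%:E = (u / (1 - u) ^+ 2)%:E)%E.
Proof.
move=> u01; have := esum_geom u01.
under eq_esum do rewrite -[X in X%:E]mul1r.
move/(esum_geom_primitive (c := fun k => k%:R)).
rewrite u01 => /(_ isT erefl _)/wrap[].
  by move=> k; rewrite -natr1.
move=> /(_ (fun=> ler01)) ->.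
by congr EFin; rewrite expr2 invfM; ring.
Qed.

Lemma esum_geom2 (u : R) : 0 <= u < 1 ->
  (\esum_(k in setT) (k%:R ^+ 2 * u ^+ k)%:E =
   (u * (1 + u) / (1 - u) ^+ 3)%:E)%E.
Proof.
move=> u01; have /andP[u0 u1] := u01.
have /(esum_geom_primitive (c := fun k => k%:R ^+ 2)) :
  (\esum_(k in setT) ((2 * k%:R + 1) * u ^+ k)%:E =
    (2 * (u / (1 - u) ^+ 2) + (1 - u)^-1)%:E)%E.
  rewrite EFinD EFinM -esum_geom1// -esum_geom// -esumZl//; last first.
    by move=> k _; rewrite lee_fin mulr_ge0// exprn_ge0.
  rewrite -esumD; try by move=> k _; rewrite ?mule_ge0 ?lee_fin// ?mulr_ge0// exprn_ge0.
  by apply: eq_esum => k _; rewrite mulrDl mul1r EFinD -mulrA EFinM.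
rewrite u01 expr0n => /(_ isT erefl)-> //; first by
  congr EFin; field; rewrite subr_eq0 gt_eqF.
by move=> k; rewrite -natr1; ring.
Qed.

End sums.
(** * Primitive lattice points in a cone *)

Section sectors.
Variable R : realType.
Implicit Types (S : set (nat * nat)) (lam h M eta b : R).

(* A cone of lattice points (q, p), q > 0, whose vertical sections are integer
   intervals with lam * q + O(1) points. *)
Record is_sector S lam : Prop := IsSector {
  sector_scale : forall k q p, S (k.+1 * q, k.+1 * p)%N <-> S (q, p) ;
  sector_pos : forall q p, S (q, p) -> (0 < q)%N ;
  sector_count : exists a b : nat -> nat, forall q, (0 < q)%N ->
    [/\ forall p, S (q, p) <-> (a q <= p < b q)%N, (a q <= b q)%N &
        `|(b q)%:R - (a q)%:R - lam * q%:R| <= 1] }.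

Definition prim S : set direction := [set x | S (val x)].

Definition lat_sum S h : \bar R :=
  \esum_(y in S) (y.1%:R * expR (- (h * y.1%:R)))%:E.

Definition prim_sum S h : \bar R :=
  \esum_(x in prim S) ((dir1 x)%:R * expR (- (h * (dir1 x)%:R)))%:E.

Definition bose_sum S h : \bar R :=
  \esum_(x in prim S) ((dir1 x)%:R / (expR (h * (dir1 x)%:R) - 1))%:E.

Lemma prim_sum_ge0 S h : (0 <= prim_sum S h)%E.
Proof. by apply: esum_ge0 => x _; rewrite lee_fin mulr_ge0 ?expR_ge0. Qed.

(** Each point (q, p) of the cone is gcd(q, p) times a unique primitive one. The index k stands for
    the multiplier [k.+1]. *)
Lemma lat_sum_prim S lam h : is_sector S lam ->
  lat_sum S h =
  (\esum_(k in [set: nat]) (k.+1%:R%:E * prim_sum S (k.+1%:R * h)))%E.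
Proof.
move=> secS; rewrite /prim_sum.
rewrite (@eq_esum _ _ _ _ (fun k => \esum_(x in prim S) (k.+1%:R%:E *
    ((dir1 x)%:R * expR (- (k.+1%:R * h * (dir1 x)%:R)))%:E)%E)); last first.
  by move=> k _; rewrite esumZl// => x _; rewrite lee_fin mulr_ge0 ?expR_ge0.
rewrite esum_esum; last first.
  by move=> k x _ _; rewrite mule_ge0 ?lee_fin// mulr_ge0 ?expR_ge0.
rewrite /lat_sum (reindex_esum (setT `*`` (fun=> prim S)) _
  (fun kx => (kx.1.+1 * dir1 kx.2, kx.1.+1 * dir2 kx.2)%N)).
  apply: eq_esum => -[k x] _ /=; rewrite natrM -EFinM; congr EFin.
  by rewrite -mulrA; congr (_ * (_ * expR _)); ring.
split.
- by move=> [k [[q p] /= cop]] [_ Sx]; apply/(sector_scale secS).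
- move=> [k [[q p] cop]] [k' [[q' p'] cop']] _ _ /= [e1 e2].
  have := congr2 gcdn e1 e2; rewrite -!muln_gcdr.
  move/eqP: (cop) => /= ->; move/eqP: (cop') => /= ->; rewrite !muln1 => -[kk].
  move: e1 e2; rewrite /dir1 /dir2 /= kk => /eqP; rewrite eqn_pmul2l// => /eqP e1.
  move=> /eqP; rewrite eqn_pmul2l// => /eqP e2.
  by congr (_, _); apply: val_inj => /=; rewrite e1 e2.
- move=> [q p] Sqp; have q0 := sector_pos secS Sqp.
  have g0 : (0 < gcdn q p)%N by rewrite gcdn_gt0 q0.
  have cop : coprime (q %/ gcdn q p) (p %/ gcdn q p).
    by rewrite /coprime -(eqn_pmul2r g0) muln_gcdl !divnK ?dvdn_gcdl ?dvdn_gcdr// mul1n.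
  have eqp : ((gcdn q p).-1.+1 * (q %/ gcdn q p),
      (gcdn q p).-1.+1 * (p %/ gcdn q p))%N = (q, p).
    by rewrite prednK// ![(gcdn q p * _)%N]mulnC !divnK ?dvdn_gcdl ?dvdn_gcdr.
  exists ((gcdn q p).-1, Sub (_, _) cop) => //; split=> //.
  by apply/(sector_scale secS (gcdn q p).-1); rewrite eqp.
Qed.

(** Expansion of 1 / (e^y - 1) as the sum of e^(- k y) over k >= 1, then exchange of the two
    sums. *)
Lemma bose_sum_prim S h : 0 < h -> (forall q p, S (q, p) -> (0 < q)%N) ->
  bose_sum S h = (\esum_(k in [set: nat]) prim_sum S (k.+1%:R * h))%E.
Proof.
move=> h0 S0; rewrite /prim_sum exchange_esum; last first.
  by move=> k x _ _; rewrite lee_fin mulr_ge0 ?expR_ge0.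
apply: eq_esum => -[[q p] cop] /= /S0 q0; rewrite /dir1/=.
have hq : 0 < h * q%:R by rewrite mulr_gt0// ltr0n.
set u := expR (- (h * q%:R)).
have u01 : 0 <= u < 1 by rewrite expR_ge0 expR_lt1 oppr_lt0.
have uE k : expR (- (k.+1%:R * h * q%:R)) = u * u ^+ k.
  by rewrite -exprS -expRM_natl; congr expR; ring.
under eq_esum do rewrite uE !EFinM.
rewrite esumZl//; last first.
  by move=> k _; rewrite -EFinM lee_fin mulr_ge0 ?expR_ge0// exprn_ge0 ?expR_ge0.
rewrite esumZl ?expR_ge0//; last by move=> k _; rewrite lee_fin exprn_ge0 ?expR_ge0.
rewrite esum_geom// -!EFinM; congr (EFin (_ * _)).
have u0 : u != 0 by rewrite gt_eqF ?expR_gt0.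
have -> : expR (h * q%:R) = u^-1 by rewrite /u expRN invrK.
have u1 : 1 - u != 0 by rewrite subr_eq0 gt_eqF//; case/andP: u01.
by field; rewrite u0 u1.
Qed.

(** Points are grouped by abscissa, [N q] being the number in column q. The absolute value makes the
    terms nonnegative from the form of the statement alone. *)
Lemma lat_sum_nat S lam h : is_sector S lam ->
  exists2 N : nat -> R, (forall q, `|N q - lam * q%:R| <= 1) &
  lat_sum S h =
    (\esum_(q in [set: nat]) (q%:R * expR (- h) ^+ q * `|N q|)%:E)%E.
Proof.
move=> secS; have [a [b ab]] := sector_count secS.
exists (fun q => if (0 < q)%N then (b q)%:R - (a q)%:R else 0).
  by case=> [|q]; rewrite ?mulr0 ?subrr ?normr0//; have [] := ab q.+1 isT.
transitivity (\esum_(q in [set: nat]) \esum_(p in [set p | S (q, p)])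
    ((q%:R * expR (- (h * q%:R)))%:E : \bar R))%E.
  rewrite esum_esum; last by move=> *; rewrite lee_fin mulr_ge0 ?expR_ge0.
  rewrite /lat_sum; congr esum.
  by apply/seteqP; split => -[q p] //= [].
apply: eq_esum => -[|q] _.
  by rewrite !mul0r esum1// => p _; rewrite !mul0r.
have [Sq abq _] := ab q.+1 isT.
have -> : [set p | S (q.+1, p)] = [set` index_iota (a q.+1) (b q.+1)].
  by apply/seteqP; split=> p /=; rewrite mem_index_iota => /Sq.
rewrite (@esum_fset _ _ [set` _]); last 2 first.
- exact: finite_seq.
- by move=> *; rewrite lee_fin mulr_ge0 ?expR_ge0.
rewrite -fsbig_seq ?iota_uniq// sumEFin big_const_nat iter_addr_0 -[X in X%:E]mulr_natr.
rewrite -[in LHS]mulNr expRM_natr ger0_norm; first by rewrite natrB.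
by rewrite subr_ge0 ler_nat.
Qed.

(** The factor r = h / (1 - e^(-h)) turns powers of 1 / (1 - u) into powers of 1 / h. The bound 27 =
    3^3 holds for all h > 0 and follows from e^(h/3) >= (1 + h) / 3. *)
Lemma expR_half_bounds h : 0 < h ->
  let u := expR (- h) in let r := h / (1 - u) in
  [/\ 0 < u < 1, 1 - h <= u, 1 <= r <= 1 + h & u * (1 + h) ^+ 3 <= 27].
Proof.
move=> h0 u r; have u01 : 0 < u < 1 by rewrite expR_gt0 expR_lt1 oppr_lt0.
have u1 : 0 < 1 - u by rewrite subr_gt0; case/andP: u01.
have hu : 1 - h <= u by rewrite -[1 - h]/(1 + - h) expR_ge1Dx.
have uV : u * expR h = 1 by rewrite /u mulrC expRxMexpNx_1.
split => //.
  rewrite /r ler_pdivlMr// ler_pdivrMr//; apply/andP; split; first lra.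
  have := expR_ge1Dx h; case/andP: u01 => u0 _ hh.
  have : u * (1 + h) <= u * expR h by rewrite ler_pM2l.
  by rewrite uV; lra.
have e3 : expR h = expR (h / 3) ^+ 3 by rewrite -expRM_natr; congr expR; field.
have : ((1 + h) / 3) ^+ 3 <= expR (h / 3) ^+ 3.
  rewrite lerXn2r ?nnegrE ?expR_ge0//; first by rewrite divr_ge0// addr_ge0// ltW.
  by apply: le_trans (expR_ge1Dx _); lra.
rewrite -e3 expr_div_n; case/andP: u01 => u0 _.
move=> /(ler_wpM2l (ltW u0)); rewrite uV; lra.
Qed.

(** With [N q] replaced by lam q up to 1, the sum is lam T up to s, where T and s are the series of
    q^2 u^q and q u^q; h^3 T = r^3 u (1 + u) tends to 2 and h^3 s is O(h). The bound 54 lam + 27,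
    valid at all scales, stands beside the asymptotics because the contraction also meets scales
    that are not small. *)
Lemma lat_sum_bound S lam h : is_sector S lam -> 0 <= lam -> 0 < h ->
  exists A : R, [/\ lat_sum S h = A%:E, 0 <= A, h ^+ 3 * A <= 54 * lam + 27 &
    h <= 1 -> `|h ^+ 3 * A - 2 * lam| <= (14 * lam + 4) * h].
Proof.
move=> secS lam0 h0; have [N NE latE] := lat_sum_nat h secS.
have [] := expR_half_bounds h0; set u := expR (- h) in latE *.
set r := h / (1 - u) => u01 hu /andP[r1 rh] u27; have /andP[u0 u1] := u01.
have u01' : 0 <= u < 1 by rewrite ltW.
have u1' : 0 < 1 - u by rewrite subr_gt0.
pose s := u / (1 - u) ^+ 2; pose T := u * (1 + u) / (1 - u) ^+ 3.
have q0 q : 0 <= q%:R * u ^+ q by rewrite mulr_ge0 ?exprn_ge0// ltW.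
have q20 q : 0 <= q%:R ^+ 2 * u ^+ q.
  by rewrite mulr_ge0 ?exprn_ge0// ltW.
have sE : (\esum_(q in setT) (q%:R * u ^+ q)%:E = s%:E)%E by rewrite esum_geom1.
have TE : (\esum_(q in setT) (lam * (q%:R ^+ 2 * u ^+ q))%:E = (lam * T)%:E)%E.
  rewrite EFinM -esum_geom2// -esumZl//; last by move=> q _; rewrite lee_fin.
have lam20 q : 0 <= lam * (q%:R ^+ 2 * u ^+ q) by rewrite mulr_ge0.
have ub : (lat_sum S h <= (lam * T + s)%:E)%E.
  rewrite EFinD -TE -sE -esumD; try by move=> q _; rewrite lee_fin.
  rewrite latE; apply: le_esum => q _; rewrite -EFinD lee_fin.
  have : `|N q| <= lam * q%:R + 1.
    have := ler_normD (N q - lam * q%:R) (lam * q%:R); rewrite subrK.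
    rewrite (ger0_norm (_ : 0 <= lam * _)) ?mulr_ge0//; have := NE q; lra.
  by move=> /(ler_wpM2l (q0 q)); lra.
have lat0 : (0 <= lat_sum S h)%E.
  by rewrite latE; apply: esum_ge0 => q _; rewrite lee_fin mulr_ge0.
have latfin : lat_sum S h \is a fin_num.
  by rewrite ge0_fin_numE// (le_lt_trans ub)// ltry.
exists (fine (lat_sum S h)); set A := fine _.
have AE : lat_sum S h = A%:E by rewrite fineK.
have A0 : 0 <= A by rewrite fine_ge0.
rewrite AE lee_fin in ub.
have lb : lam * T <= A + s.
  rewrite -lee_fin EFinD -TE -sE -AE latE -esumD; last 2 first.
  - by move=> q _; rewrite lee_fin mulr_ge0.
  - by move=> q _; rewrite lee_fin.
  apply: le_esum => q _; rewrite -EFinD lee_fin.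
  have : lam * q%:R <= `|N q| + 1.
    have := ler_norm (lam * q%:R - N q); rewrite distrC.
    have := ler_norm (N q); have := NE q; lra.
  by move=> /(ler_wpM2l (q0 q)); lra.
have Tr : h ^+ 3 * T = r ^+ 3 * (u * (1 + u)).
  by rewrite /T /r; field; rewrite lt0r_neq0.
have sr : h ^+ 3 * s = h * (r ^+ 2 * u).
  by rewrite /s /r; field; rewrite lt0r_neq0.
have h30 : 0 <= h ^+ 3 by rewrite exprn_ge0// ltW.
have {}ub := ler_wpM2l h30 ub; have {}lb := ler_wpM2l h30 lb.
rewrite !mulrDr !(mulrCA _ lam) Tr sr in ub lb.
have r0 : 0 <= r by lra.
have r2 : r ^+ 2 <= (1 + h) ^+ 2 by rewrite lerXn2r ?nnegrE//; lra.
have r3 : r ^+ 3 <= (1 + h) ^+ 3 by rewrite lerXn2r ?nnegrE//; lra.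
have r31 : 1 <= r ^+ 3 by rewrite exprn_ege1.
have u0' := ltW u0; have h0' := ltW h0.
have Tge : 0 <= r ^+ 3 * (u * (1 + u)).
  apply: mulr_ge0; first exact: exprn_ge0.
  by apply: mulr_ge0 => //; exact: addr_ge0.
have sge : 0 <= h * (r ^+ 2 * u).
  by apply: mulr_ge0 => //; apply: mulr_ge0 => //; exact: sqr_ge0.
have Tle : r ^+ 3 * (u * (1 + u)) <= 2 * (u * (1 + h) ^+ 3).
  apply: le_trans (_ : (1 + h) ^+ 3 * (u * (1 + u)) <= _).
    by rewrite ler_wpM2r// mulr_ge0 ?addr_ge0//.
  have : 0 <= u * (1 + h) ^+ 3 by rewrite mulr_ge0 ?exprn_ge0 ?addr_ge0//.
  nra.
have sle : h * (r ^+ 2 * u) <= h * ((1 + h) ^+ 2 * u).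
  by rewrite ler_pM2l// ler_pM2r.
split=> //.
  have : h * ((1 + h) ^+ 2 * u) <= u * (1 + h) ^+ 3.
    have : 0 <= (1 + h) ^+ 2 * u by rewrite mulr_ge0 ?sqr_ge0//.
    by rewrite !exprS expr0; nra.
  have : lam * (r ^+ 3 * (u * (1 + u))) <= lam * 54 by rewrite ler_wpM2l//; lra.
  lra.
move=> h1.
have T1 : r ^+ 3 * (u * (1 + u)) <= 2 + 14 * h.
  have : u * (1 + h) ^+ 3 <= (1 + h) ^+ 3.
    by rewrite ger_pMl ?exprn_gt0 ?addr_gt0// ltW.
  have : (1 + h) ^+ 3 <= 1 + 7 * h.
    have hh : 0 <= h * (1 - h) by rewrite mulr_ge0//; lra.
    have hhh : 0 <= h * (h * (1 - h)) by rewrite mulr_ge0// ltW.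
    by rewrite !exprS expr0; lra.
  lra.
have T2 : 2 - 3 * h <= r ^+ 3 * (u * (1 + u)).
  apply: (@le_trans _ _ (u * (1 + u))); first nra.
  by rewrite ler_peMl// mulr_ge0 ?addr_ge0//.
have s1 : h * (r ^+ 2 * u) <= 4 * h.
  apply: le_trans sle _; rewrite mulrC ler_pM2r//.
  have : (1 + h) ^+ 2 <= 4 by rewrite expr2; nra.
  have : 0 <= (1 + h) ^+ 2 by rewrite sqr_ge0.
  nra.
have lT1 := ler_wpM2l lam0 T1; have lT2 := ler_wpM2l lam0 T2.
have lh : 0 <= lam * h by rewrite mulr_ge0// ltW.
by rewrite ler_norml; apply/andP; split; lra.
Qed.


(** [prim_sum] is the first term of the decomposition of [lat_sum], hence inherits its bound. *)
Lemma sector_prim_bounded S lam h : is_sector S lam -> 0 <= lam -> 0 < h ->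
  exists2 P : R, prim_sum S h = P%:E & 0 <= h ^+ 3 * P <= 54 * lam + 27.
Proof.
move=> secS lam0 h0; have [A [AE A0 Ab _]] := lat_sum_bound secS lam0 h0.
have PA : (prim_sum S h <= A%:E)%E.
  rewrite -AE (lat_sum_prim h secS) esum_nat_recl; last first.
    by move=> k; rewrite mule_ge0 ?lee_fin ?prim_sum_ge0.
  rewrite !mul1e mul1r leeDl// esum_ge0// => k _.
  by rewrite mule_ge0 ?lee_fin ?prim_sum_ge0.
have Pfin : prim_sum S h \is a fin_num.
  by rewrite ge0_fin_numE ?prim_sum_ge0// (le_lt_trans PA)// ltry.
exists (fine (prim_sum S h)); first by rewrite fineK.
have h3 : 0 < h ^+ 3 by rewrite exprn_gt0.
rewrite mulr_ge0 ?fine_ge0 ?prim_sum_ge0 ?(ltW h3)//=.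
apply: le_trans Ab; rewrite ler_pM2l// -lee_fin fineK//.
Qed.

(** The quantity estimated is the sum of (v_k - c) / (k+1)^s over k >= n. It is the difference of
    two tails of nonnegative series, each between 0 and B / n. *)
Lemma dirichlet_cmp s (v : nat -> R) (V c B : R) n : (2 <= s)%N -> (0 < n)%N ->
  (forall k, 0 <= v k <= B) -> 0 <= c <= B ->
  (\esum_(k in [set: nat]) (v k / k.+1%:R ^+ s)%:E = V%:E)%E ->
  `|V - c * zeta R s - \sum_(k < n) (v k - c) / k.+1%:R ^+ s| <= B / n%:R.
Proof.
move=> s2 n0 vB /andP[c0 cB] VE.
have v0 k : 0 <= v k / k.+1%:R ^+ s.
  by rewrite divr_ge0 ?exprn_ge0//; case/andP: (vB k).
have inv_le (k : nat) : (k.+1%:R ^+ s)^-1 <= (k.+1%:R ^+ 2)^-1 :> R.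
  by rewrite lef_pV2 ?posrE ?exprn_gt0// ler_weXn2l// ler1n.
have h1 := ge_esum_nat n v0 VE.
have h2 : V <= \sum_(k < n) v k / k.+1%:R ^+ s + B / n%:R.
  apply: esum_nat_tail v0 _ VE => // k; have /andP[vk0 vkB] := vB k.
  by rewrite ler_pM// invr_ge0 exprn_ge0.
have h3 := ler_wpM2l c0 (zeta_sum_le R n s2).
have h4 := ler_wpM2l c0 (zeta_tail R s2 n0).
have h5 : c * n%:R^-1 <= B * n%:R^-1 by rewrite ler_wpM2r// invr_ge0.
have -> : \sum_(k < n) (v k - c) / k.+1%:R ^+ s =
    \sum_(k < n) v k / k.+1%:R ^+ s - c * \sum_(k < n) (k.+1%:R ^+ s)^-1.
  by rewrite mulr_sumr -sumrB; apply: eq_bigr => k _; rewrite mulrBl.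
rewrite mulrDr in h4; move: h1 h2 h3 h4 h5.
set x := \sum_(k < n) _; set y := \sum_(k < n) _.
by move=> *; rewrite ler_norml; apply/andP; split; lra.
Qed.

Lemma norm_sum_div_le s (e : nat -> R) (b : R) m n : (2 <= s)%N ->
  (forall k : nat, (k < n)%N -> `|e k| <= b) ->
  `|\sum_(m <= k < n) e k / k.+1%:R ^+ s| <=
    b * \sum_(m <= k < n) (k.+1%:R ^+ s)^-1.
Proof.
move=> s2 eb; apply: le_trans (ler_norm_sum _ _ _) _.
rewrite mulr_sumr big_nat_cond [leRHS]big_nat_cond; apply: ler_sum => k.
rewrite andbT => /andP[_ kn]; rewrite normrM [`|_^-1|]ger0_norm.
  by rewrite ler_wpM2r ?eb// invr_ge0 exprn_ge0.
by rewrite invr_ge0 exprn_ge0.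
Qed.

(** The limit 2 lam of h^3 [lat_sum] times the density 1 / zeta(2) of primitive points among lattice
    points. *)
Definition sector_density lam : R := 2 * lam / zeta R 2.

Lemma sector_density_bound lam M : 0 <= lam <= M ->
  0 <= sector_density lam <= 54 * M + 27.
Proof.
move=> /andP[l0 lM]; have z1 := @zeta_ge1 R 2 isT.
have z0 : 0 < zeta R 2 by lra.
rewrite divr_ge0 ?mulr_ge0 ?(ltW z0)//= ler_pdivrMr//.
have : (54 * M + 27) * 1 <= (54 * M + 27) * zeta R 2.
  by rewrite ler_wpM2l//; lra.
lra.
Qed.

Lemma small_inv (B eta : R) : 0 <= B -> 0 < eta ->
  exists2 n : nat, (0 < n)%N & B / n%:R <= eta.
Proof.
move=> B0 eta0; exists (Num.truncn (B / eta)).+1 => //.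
rewrite ler_pdivrMr ?ltr0n// mulrC -ler_pdivrMr//.
by rewrite ltW// truncnS_gt.
Qed.

(* One step of the contraction: the error in the density of primitive points is
   governed, through [lat_sum_prim], by the errors at the scales 2h, 3h, ...
   with total weight zeta(2) - 1 <= 3/4. *)
Lemma prim_density_contract M eta b : 0 <= M -> 0 < eta -> 0 <= b ->
  (exists2 h0 : R, 0 < h0 & forall S lam h, is_sector S lam -> 0 <= lam <= M ->
     0 < h < h0 ->
     `|h ^+ 3 * fine (prim_sum S h) - sector_density lam| <= b) ->
  (exists2 h0 : R, 0 < h0 & forall S lam h, is_sector S lam -> 0 <= lam <= M ->
     0 < h < h0 ->
     `|h ^+ 3 * fine (prim_sum S h) - sector_density lam| <=
       3 / 4 * b + eta).
Proof.
move=> M0 eta0 b0 [h0 h00 hb].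
pose B := 54 * M + 27; have B0 : 0 <= B by rewrite addr_ge0// mulr_ge0.
have e20 : 0 < eta / 2 by rewrite divr_gt0.
have [n n0 nB] := small_inv B0 e20.
pose C := 14 * M + 4; have C0 : 0 < C by rewrite ltr_wpDl ?mulr_ge0.
(* Below h0 / n the scales 2h, ..., n h are all covered by the assumed bound b; the other two
   conditions make the error (14 lam + 4) h of the full lattice sum at most eta / 2. *)
exists (Num.min (h0 / n%:R) (Num.min 1 (eta / 2 / C))).
  by rewrite !lt_min ltr01 !divr_gt0// ltr0n.
move=> S lam h secS lamM /andP[hgt]; rewrite !lt_min => /and3P[hn h1 hC].
have /andP[lam0 lM] := lamM.
have [A [AE A0 Ab Ah]] := lat_sum_bound secS lam0 hgt.
pose v k := (k.+1%:R * h) ^+ 3 * fine (prim_sum S (k.+1%:R * h)).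
have kh (k : nat) : 0 < k.+1%:R * h by rewrite mulr_gt0.
have vB k : 0 <= v k <= B.
  have [P PE /andP[P0 PB]] := sector_prim_bounded secS lam0 (kh k).
  by rewrite /v PE /= P0 (le_trans PB)// lerD2r ler_wpM2l.
have /andP[p0 pB] := sector_density_bound lamM.
set p := sector_density lam in p0 pB *.
(* Since (kh)^3 P(kh) / k^2 = h^3 k P(kh), the decomposition becomes a Dirichlet sum of exponent 2
   with bounded coefficients. *)
have VE : (\esum_(k in [set: nat]) (v k / k.+1%:R ^+ 2)%:E
    = (h ^+ 3 * A)%:E)%E.
  rewrite EFinM -AE (lat_sum_prim h secS) -esumZl; last 2 first.
  - by rewrite exprn_ge0// ltW.
  - by move=> k _; rewrite mule_ge0 ?lee_fin ?prim_sum_ge0.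
  apply: eq_esum => k _.
  have [P PE _] := sector_prim_bounded secS lam0 (kh k).
  rewrite /v PE /= -!EFinM; congr EFin.
  have key (y : R) : y != 0 -> (y * h) ^+ 3 * P / y ^+ 2 = h ^+ 3 * (y * P).
    by move=> y0; field.
  by rewrite key ?pnatr_eq0.
have cmp := @dirichlet_cmp 2 v _ p B n isT n0 vB _ VE.
have {}cmp := cmp (introT andP (conj p0 pB)).
have pz : p * zeta R 2 = 2 * lam.
  by rewrite /p /sector_density divfK// gt_eqF// (lt_le_trans ltr01)// zeta_ge1.
have e0 : v 0%N = h ^+ 3 * fine (prim_sum S h) by rewrite /v mul1r.
(* The term of index 0 is the wanted error at scale h itself; the others carry total weight at most
   zeta(2) - 1. *)
rewrite -(big_mkord xpredT (fun k => (v k - p) / k.+1%:R ^+ 2)) in cmp.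
rewrite big_ltn// expr1n divr1 e0 pz in cmp.
have tail := @norm_sum_div_le 2 (fun k => v k - p) b 1 n isT.
have {}tail : `|\sum_(1 <= k < n) (v k - p) / k.+1%:R ^+ 2| <= 3 / 4 * b.
  apply: le_trans (tail _) _.
    move=> k kn; apply: hb => //; rewrite kh/=.
    rewrite (le_lt_trans _ (_ : n%:R * h < _))//.
      by rewrite ler_pM2r// ler_nat.
    by rewrite mulrC -ltr_pdivlMr// ltr0n.
  rewrite mulrC ler_wpM2r//.
  have := @zeta_sum_le R 2 n isT.
  rewrite -(big_mkord xpredT (fun k : nat => (k.+1%:R ^+ 2)^-1 : R)) big_ltn//.
  rewrite expr1n invr1; have := @zeta2_le R; lra.
have {}Ah : `|h ^+ 3 * A - 2 * lam| <= eta / 2.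
  apply: le_trans (Ah (ltW h1)) _.
  have : (14 * lam + 4) * h <= C * h.
    by rewrite ler_pM2r// lerD2r ler_wpM2l.
  by move: hC; rewrite ltr_pdivlMr//; lra.
move: cmp tail Ah; rewrite !ler_norml => /andP[? ?] /andP[? ?] /andP[? ?].
by apply/andP; split; lra.
Qed.

(** The contraction starts from the bound 54 M + 27 common to h^3 P(h) and its limit, and is applied
    j times with j depending only on M and eta; hence one [h0] serves all sectors. *)
Lemma prim_density M eta : 0 <= M -> 0 < eta ->
  exists2 h0 : R, 0 < h0 & forall S lam h, is_sector S lam -> 0 <= lam <= M ->
     0 < h < h0 ->
     `|h ^+ 3 * fine (prim_sum S h) - sector_density lam| <= eta.
Proof.
move=> M0 eta0.
pose B := 54 * M + 27; have B0 : 0 <= B by rewrite addr_ge0// mulr_ge0.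
have iterE : forall j : nat, exists2 h0 : R, 0 < h0 &
    forall S lam h, is_sector S lam -> 0 <= lam <= M -> 0 < h < h0 ->
    `|h ^+ 3 * fine (prim_sum S h) - sector_density lam| <=
      (3 / 4) ^+ j * B + eta / 2.
  elim=> [|j IH].
    exists 1 => // S lam h secS lamM /andP[h0 _]; rewrite expr0 mul1r.
    have /andP[p0 pB] := sector_density_bound lamM.
    have /andP[lam0 lM] := lamM.
    have [P -> /= /andP[P0 PB]] := sector_prim_bounded secS lam0 h0.
    have PB' : h ^+ 3 * P <= B by rewrite (le_trans PB)// lerD2r ler_wpM2l.
    rewrite -/B in pB.
    by rewrite ler_norml; apply/andP; split; lra.
  (* The allowance eta / 8 reproduces eta / 2: 3/4 * eta/2 + eta/8 = eta/2. *)
  have [||h0 h00 hb] := prim_density_contract M0 _ _ IH (eta := eta / 8).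
  - by rewrite divr_gt0.
  - by rewrite addr_ge0 ?mulr_ge0 ?exprn_ge0// ?divr_ge0// ltW.
  exists h0 => // S lam h secS lamM hh; apply: le_trans (hb _ _ _ secS lamM hh) _.
  by rewrite exprS; lra.
have q1 : `|3 / 4 : R| < 1 by rewrite ger0_norm; lra.
have e20 : 0 < eta / 2 by rewrite divr_gt0.
have [j jB] : exists j : nat, (3 / 4) ^+ j * B <= eta / 2.
  have := @cvg_geometric R B _ q1 => /cvgrPdist_le/(_ _ e20)[j _ /(_ j (leqnn j))].
  rewrite /= sub0r normrN => jb; exists j; rewrite mulrC.
  exact: le_trans (ler_norm _) jb.
have [h0 h00 hb] := iterE j; exists h0 => // S lam h secS lamM hh.
by apply: le_trans (hb _ _ _ secS lamM hh) _; lra.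
Qed.

(** h^3 W(h) is the sum of (kh)^3 P(kh) / k^3, and each coefficient tends to 2 lam / zeta(2) with h:
    the exponent 3 brings in zeta(3), and kappa^3 is the resulting constant. *)
Lemma bose_sum_asymptotics M eta : 0 <= M -> 0 < eta ->
  exists2 h0 : R, 0 < h0 & forall S lam h, is_sector S lam -> 0 <= lam <= M ->
    0 < h < h0 ->
    exists2 W, bose_sum S h = W%:E & `|h ^+ 3 * W - kappa R ^+ 3 * lam| <= eta.
Proof.
move=> M0 eta0.
pose B := 54 * M + 27; have B0 : 0 <= B by rewrite addr_ge0// mulr_ge0.
have z3 : 0 < zeta R 3 by rewrite (lt_le_trans ltr01)// zeta_ge1.
have e20 : 0 < eta / 2 by rewrite divr_gt0.
have [n n0 nB] := small_inv B0 e20.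
have [h0 h00 hb] := prim_density M0 (divr_gt0 e20 z3).
exists (h0 / n%:R) => [|S lam h secS lamM /andP[hgt hn]].
  by rewrite divr_gt0// ltr0n.
have /andP[lam0 lM] := lamM.
pose v k := (k.+1%:R * h) ^+ 3 * fine (prim_sum S (k.+1%:R * h)).
have kh (k : nat) : 0 < k.+1%:R * h by rewrite mulr_gt0.
have vB k : 0 <= v k <= B.
  have [P PE /andP[P0 PB]] := sector_prim_bounded secS lam0 (kh k).
  by rewrite /v PE /= P0 (le_trans PB)// lerD2r ler_wpM2l.
have vb3 k : v k / k.+1%:R ^+ 3 <= B * (k.+1%:R ^+ 3)^-1.
  by rewrite ler_wpM2r ?invr_ge0 ?exprn_ge0//; case/andP: (vB k).
have v03 k : 0 <= v k / k.+1%:R ^+ 3.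
  by rewrite divr_ge0 ?exprn_ge0//; case/andP: (vB k).
have h3 : 0 < h ^+ 3 by rewrite exprn_gt0.
have VE : (\esum_(k in [set: nat]) (v k / k.+1%:R ^+ 3)%:E
    = (h ^+ 3)%:E * bose_sum S h)%E.
  rewrite bose_sum_prim//; last exact: sector_pos secS.
  rewrite -esumZl ?(ltW h3)//; last by move=> k _; rewrite prim_sum_ge0.
  apply: eq_esum => k _.
  have [P PE _] := sector_prim_bounded secS lam0 (kh k).
  rewrite /v PE /= -!EFinM; congr EFin.
  have key (y : R) : y != 0 -> (y * h) ^+ 3 * P / y ^+ 3 = h ^+ 3 * P.
    by move=> y0; field.
  by rewrite key ?pnatr_eq0.
have Vfin : (\esum_(k in [set: nat]) (v k / k.+1%:R ^+ 3)%:E <=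
    (B * zeta R 3)%:E)%E.
  apply: esum_nat_fin_ub => // m.
  apply: (@le_trans _ _ (B * \sum_(k < m) (k.+1%:R ^+ 3)^-1)).
    by rewrite mulr_sumr; apply: ler_sum.
  by rewrite ler_wpM2l// zeta_sum_le.
have b0 : (0 <= bose_sum S h)%E.
  apply: esum_ge0 => x _; rewrite lee_fin divr_ge0// subr_ge0.
  by rewrite -expR0 ler_expR mulr_ge0// ltW.
have bfin : bose_sum S h \is a fin_num.
  rewrite ge0_fin_numE//; move: Vfin; rewrite VE -lee_pdivlMl// => /le_lt_trans.
  by apply; rewrite ltry.
exists (fine (bose_sum S h)); first by rewrite fineK.
set W := fine _; have WE : bose_sum S h = W%:E by rewrite fineK.
rewrite WE -EFinM in VE.
have /andP[p0 pB] := sector_density_bound lamM.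
set p := sector_density lam in p0 pB.
have cmp := @dirichlet_cmp 3 v _ p B n isT n0 vB _ VE.
have {}cmp := cmp (introT andP (conj p0 pB)).
have pz : p * zeta R 3 = kappa R ^+ 3 * lam.
  by rewrite kappa3 /p /sector_density; ring.
rewrite -(big_mkord xpredT (fun k => (v k - p) / k.+1%:R ^+ 3)) pz in cmp.
have tail := @norm_sum_div_le 3 (fun k => v k - p) (eta / 2 / zeta R 3) 0 n isT.
have {}tail : `|\sum_(0 <= k < n) (v k - p) / k.+1%:R ^+ 3| <= eta / 2.
  apply: le_trans (tail _) _.
    move=> k kn; apply: hb => //; rewrite kh/=.
    rewrite (le_lt_trans _ (_ : n%:R * h < _))//.
      by rewrite ler_pM2r// ler_nat.
    by rewrite mulrC -ltr_pdivlMr// ltr0n.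
  rewrite -[leRHS](divfK (lt0r_neq0 z3)) ler_wpM2l//.
    by rewrite divr_ge0 ?(ltW e20) ?(ltW z3).
  by rewrite big_mkord zeta_sum_le.
move: cmp tail; rewrite !ler_norml => /andP[? ?] /andP[? ?].
by apply/andP; split; lra.
Qed.

End sectors.
(** * Calculus on the unit interval *)

Section unit_interval_calculus.
Variable R : realType.
Implicit Types (f : R -> R) (x y a b : R).

Local Notation I := (`[0, 1]%classic : set R).

Lemma derivableI_cvg f x : derivableI f x ->
  diffq f x y @[y --> within I x^'] --> derI f x.
Proof. by []. Qed.

Lemma derivableI_continuous f :
  (forall x, x \in `[0, 1] -> derivableI f x) -> {within I, continuous f}.
Proof.
move=> df; apply/subspace_continuousP => x Ix.
have /df/derivableI_cvg dfx : x \in `[0, 1] by [].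
have cvx : f y @[y --> within I x^'] --> f x.
  have h : (f x + diffq f x y * (y - x)) @[y --> within I x^'] --> f x + derI f x * (x - x).
    apply: cvgD; first exact: cvg_cst.
    apply: cvgM => //; apply: cvgB; last exact: cvg_cst.
    apply: cvg_within_filter; exact: cvg_within.
  rewrite subrr mulr0 addr0 in h; apply: cvg_trans h; apply: near_eq_cvg.
  rewrite /dnbhs !near_withinE; near=> y => yx _.
  by rewrite /diffq divfK ?subr_eq0// addrC subrK.
apply/cvgrPdist_le => e e0; move/cvgrPdist_le : cvx => /(_ e e0).
rewrite /dnbhs !near_withinE => h.
near=> y => Iy; have [->|yx] := eqVneq y x; first by rewrite subrr normr0 ltW.
by move: yx Iy; near: y.
Unshelve. all: by end_near. Qed.

(** Near an interior point the restriction to [0, 1] is void, so the relative derivative is an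
    ordinary one and the library's mean value theorem becomes available. *)
Lemma derivableI_is_derive f x : 0 < x < 1 -> derivableI f x ->
  is_derive x 1 f (derI f x).
Proof.
move=> /andP[x0 x1] /derivableI_cvg dfx.
suff H : (fun h => h^-1 *: ((f \o shift x) (h *: (1 : R)) - f x)) @ 0^' --> derI f x.
  by apply: DeriveDef; [exact: cvgP H|exact/cvg_lim].
apply/cvgrPdist_le => e e0; move/cvgrPdist_le : dfx => /(_ e e0).
rewrite /dnbhs !near_withinE => /nbhs_ballP[d /= d0 dh].
apply/nbhs_ballP.
exists (Num.min d (Num.min x (1 - x))).
  by rewrite /= !lt_min d0 x0 subr_gt0.
move=> h; rewrite /ball/= sub0r normrN !lt_min => /and3P[hd hx h1] hn0.
have := dh (h + x); rewrite /ball/= opprD addrCA subrr addr0 normrN => /(_ hd).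
have hxx : h + x != x by rewrite -subr_eq0 addrK.
move=> /(_ hxx) /(_ _)/wrap[|].
  rewrite /= in_itv/=; move: hx h1; rewrite !ltr_norml => /andP[? ?] /andP[? ?].
  by apply/andP; split; lra.
by rewrite /diffq addrK mulrC /GRing.scale/= mulr1.
Qed.

Lemma derivableI_MVT f a b : (forall x, x \in `[0, 1] -> derivableI f x) ->
  0 <= a -> a <= b -> b <= 1 ->
  exists2 c, a <= c <= b & f b - f a = derI f c * (b - a).
Proof.
move=> df a0 ab b1.
have [||c] := @MVT_segment R f (derI f) a b ab.
- move=> x; rewrite in_itv/= => /andP[ax xb].
  by apply: derivableI_is_derive; [lra|apply: df; rewrite in_itv/=; lra].
- apply: continuous_subspaceW (derivableI_continuous df) => x /=.
  by rewrite !in_itv/= => /andP[? ?]; apply/andP; split; lra.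
by rewrite in_itv/= => ? ?; exists c.
Qed.

Lemma continuousI_bounded f : {within I, continuous f} ->
  exists2 K, 0 <= K & forall x, 0 <= x <= 1 -> `|f x| <= K.
Proof.
move=> cf.
have [c _ fc] := EVT_max ler01 cf; have [d _ fd] := EVT_min ler01 cf.
exists (`|f c| + `|f d|) => [|x x01]; first by rewrite addr_ge0.
have xI : x \in `[0, 1] by rewrite in_itv.
have := fc _ xI; have := fd _ xI.
have := ler_norm (f c); have := ler_norm (- f d); rewrite normrN => *.
rewrite ler_norml; have := normr_ge0 (f c); have := normr_ge0 (f d).
by move=> *; apply/andP; split; lra.
Qed.

End unit_interval_calculus.

(** * Slope, arc length and inverse slope of the curve *)

Section convex_curve.
Variable R : realType.

(* What is used of the curve: the slope function [s = g'], its derivative [k]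
   and bounds on [k] and on the Lipschitz constant of [k]. *)
Record regular_slope (s k : R -> R) (k0 k1 k2 : R) : Prop := RegularSlope {
  rs_k0 : 0 < k0 ;
  rs_k2 : 0 <= k2 ;
  rs_bound : forall u, 0 <= u <= 1 -> k0 <= k u <= k1 ;
  rs_lip : forall u v, 0 <= u <= 1 -> 0 <= v <= 1 ->
    `|k u - k v| <= k2 * `|u - v| ;
  rs_MVT : forall u v, 0 <= u -> u <= v -> v <= 1 ->
    exists2 w, u <= w <= v & s v - s u = k w * (v - u) ;
  rs_ge0 : 0 <= s 0 ;
  rs_cont : {within `[0, 1], continuous s} }.

(** The factor (1 + g'^2)^(-3/2) is at most 1, so the bound [K0] on the curvature is also one on
    g''. The constants k1 and k2 bound |g''| and |g'''|. *)
Lemma regular_slope_derI (g : R -> R) : CkI 3 g -> strictly_increasingI g ->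
  curvature_bounded_below g ->
  exists k0 k1 k2, regular_slope (derI g) (derI (derI g)) k0 k1 k2.
Proof.
move=> [dg g3c] gi [K0 K00 gK0].
have d0 := dg 0%N isT; have d1 := dg 1%N isT; have d2 := dg 2%N isT.
rewrite /= in d0 d1 d2 g3c.
have c2 := derivableI_continuous d2; have c1 := derivableI_continuous d1.
have [k1 k10 k1E] := continuousI_bounded c2.
have [k2 k20 k2E] := continuousI_bounded g3c.
have lip u v : 0 <= u -> u <= v -> v <= 1 ->
    `|derI (derI g) v - derI (derI g) u| <= k2 * (v - u).
  move=> u0 uv v1; have [w /andP[uw wv] ->] := derivableI_MVT d2 u0 uv v1.
  rewrite normrM (ger0_norm (_ : 0 <= v - u)) ?subr_ge0// ler_wpM2r ?subr_ge0//.
  by apply: k2E; apply/andP; split; lra.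
exists K0, k1, k2; split=> //.
- move=> u u01; rewrite (le_trans (ler_norm _) (k1E u u01)) andbT.
  have := gK0 u; rewrite in_itv/= => /(_ u01).
  set p := _ `^ _ => hp.
  have p1 : p <= 1.
    have h1 : 1 <= 1 + derI g u ^+ 2 by rewrite lerDl sqr_ge0.
    by have := @ler_powR _ _ h1 (- (3 / 2)) 0; rewrite powRr0; apply; lra.
  have p0 : 0 <= p by rewrite powR_ge0.
  have g20 : 0 < derI (derI g) u.
    rewrite ltNge; apply/negP => g20.
    have : derI (derI g) u * p <= 0 by rewrite mulr_le0_ge0.
    lra.
  apply: le_trans hp _; rewrite ger_pMr//.
- move=> u v /andP[u0 u1] /andP[v0 v1]; have [uv|vu] := leP u v.
    by rewrite distrC [`|u - v|]distrC [`|v - u|]ger0_norm ?subr_ge0// lip.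
  have uv' : 0 <= u - v by rewrite subr_ge0 ltW.
  by rewrite [`|u - v|]ger0_norm// lip// ltW.
- by move=> u v u0 uv v1; exact: (derivableI_MVT d1 u0 uv v1).
- rewrite leNgt; apply/negP => g10.
  (* If g'(0) < 0, then g' is at most g'(0) / 2 on [0, x], because g'' <= k1; this contradicts g 0 <
     g x. The 1 in k1 + 1 keeps the denominator positive. *)
  pose x := Num.min 1 (- derI g 0 / (2 * (k1 + 1))).
  have k1p : 0 < k1 + 1 by rewrite ltr_wpDl.
  have x0 : 0 < x by rewrite lt_min ltr01 divr_gt0 ?mulr_gt0// oppr_gt0.
  have x1 : x <= 1 by rewrite ge_min lexx.
  have [c /andP[c0 cx] gE] := derivableI_MVT d0 (lexx 0) (ltW x0) x1.
  have : 0 < g x - g 0.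
    by rewrite subr_gt0; apply: gi => //; rewrite in_itv/= ?lexx ?ler01// x1 ltW.
  rewrite gE subr0 pmulr_lgt0// => gc0.
  have c1' : c <= 1 by lra.
  have [w /andP[w0 wc] g1E] := derivableI_MVT d1 (lexx 0) c0 c1'.
  have : derI (derI g) w <= k1.
    by apply: le_trans (ler_norm _) _; apply: k1E; rewrite w0 (le_trans wc).
  move=> /(ler_wpM2r c0); rewrite subr0 in g1E.
  have : k1 * c <= (k1 + 1) * x.
    by rewrite ler_pM// lerDl.
  have : x <= - derI g 0 / (2 * (k1 + 1)) by rewrite ge_min lexx orbT.
  rewrite ler_pdivlMr ?mulr_gt0//; lra.
Qed.

Section slope_function.
Variables (s k : R -> R) (k0 k1 k2 : R).
Hypothesis sk : regular_slope s k k0 k1 k2.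

Lemma slope_growth u v : 0 <= u -> u <= v -> v <= 1 ->
  k0 * (v - u) <= s v - s u <= k1 * (v - u).
Proof.
move=> u0 uv v1; have [w /andP[uw wv] ->] := rs_MVT sk u0 uv v1.
have /andP[kw0 kw1] : k0 <= k w <= k1 by apply: (rs_bound sk); lra.
by rewrite !ler_wpM2r ?subr_ge0.
Qed.

Lemma slope_le u v : 0 <= u -> u <= v -> v <= 1 -> s u <= s v.
Proof.
move=> u0 uv v1; have /andP[h _] := slope_growth u0 uv v1.
rewrite -subr_ge0; apply: le_trans h.
by rewrite mulr_ge0 ?subr_ge0// ltW// (rs_k0 sk).
Qed.

Lemma slope_lt u v : 0 <= u -> u < v -> v <= 1 -> s u < s v.
Proof.
move=> u0 uv v1; have /andP[h _] := slope_growth u0 (ltW uv) v1.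
rewrite -subr_gt0; apply: lt_le_trans h.
by rewrite mulr_gt0 ?subr_gt0// (rs_k0 sk).
Qed.

Lemma slope_leE u v : 0 <= u <= 1 -> 0 <= v <= 1 -> (s u <= s v) = (u <= v).
Proof.
move=> /andP[u0 u1] /andP[v0 v1]; have [uv|vu] := leP u v; first exact: slope_le.
by apply/negbTE; rewrite -ltNge slope_lt.
Qed.

Lemma slope_nonneg u : 0 <= u <= 1 -> 0 <= s u.
Proof.
move=> /andP[u0 u1]; apply: le_trans (rs_ge0 sk) _; exact: slope_le.
Qed.

Lemma slope_IVT t : s 0 <= t <= s 1 -> exists2 u, 0 <= u <= 1 & s u = t.
Proof.
move=> /andP[t0 t1]; have [|c] := IVT ler01 (rs_cont sk) (v := t).
  have s01 : s 0 <= s 1 by apply: slope_le.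
  by rewrite (min_idPl s01) (max_idPr s01) t0.
by rewrite in_itv/= => ? <-; exists c.
Qed.

Definition speed u : R := Num.sqrt (1 + s u ^+ 2).

Lemma speed_ge1 u : 1 <= speed u.
Proof.
by rewrite -[X in X <= _]sqrtr1 ler_sqrt ?lerDl ?sqr_ge0// addr_ge0 ?sqr_ge0.
Qed.

Lemma speed_le u v : 0 <= u -> u <= v -> v <= 1 -> speed u <= speed v.
Proof.
move=> u0 uv v1; rewrite ler_sqrt ?addr_ge0 ?sqr_ge0// lerD2l.
have su : 0 <= s u by apply: slope_nonneg; lra.
have suv := slope_le u0 uv v1.
by rewrite lerXn2r ?nnegrE// (le_trans su).
Qed.

(** By conversion [len_gamma g t] is [arclen (derI g) (u_gamma g t)]. *)
Definition arclen u : R :=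
  (\int[lebesgue_measure]_(x in `[0%R, u]) speed x)%R.

Lemma arclen_bounds u v : 0 <= u -> u <= v -> v <= 1 ->
  speed u * (v - u) <= arclen v - arclen u <= speed v * (v - u).
Proof.
move=> u0 uv v1.
have cs a b : 0 <= a -> b <= 1 -> {within `[a, b], continuous speed}.
  move=> a0 b1; have cs01 : {within `[0, 1], continuous speed}.
    have c1 : {within `[0, 1], continuous (fun x => 1 + s x * s x)}.
      by move=> x; apply: cvgD; [exact: cvg_cst|apply: cvgM; exact: (rs_cont sk)].
    have -> : speed = Num.sqrt \o (fun x => 1 + s x * s x).
      by apply/funext => x; rewrite /speed expr2.
    by move=> x; exact: (continuous_comp (c1 x) (@sqrt_continuous R _)).
  apply: continuous_subspaceW cs01 => x /=; rewrite !in_itv/= => /andP[? ?].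
  by apply/andP; split; lra.
have int a b : 0 <= a -> b <= 1 ->
    lebesgue_measure.-integrable `[a, b] (EFin \o speed).
  by move=> a0 b1; apply: continuous_compact_integrable;
    [exact: segment_compact|exact: cs].
have intoc : lebesgue_measure.-integrable `]u, v] (EFin \o speed).
  by apply: integrableS (int u v u0 v1) => // x /=; rewrite !in_itv/= => /andP[/ltW-> ->].
have intc (c : R) : lebesgue_measure.-integrable `]u, v] (EFin \o (fun=> c)).
  have h : lebesgue_measure.-integrable `[u, v] (EFin \o (fun=> c)).
    apply: continuous_compact_integrable; first exact: segment_compact.
    by apply: continuous_subspaceT => x; exact: cvg_cst.
  by apply: integrableS h => // x /=; rewrite !in_itv/= => /andP[/ltW-> ->].
have muE : fine (lebesgue_measure (`]u, v] : set R)) = v - u.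
  rewrite lebesgue_measure_itv/= lte_fin; case: ltP => //= vu.
  by rewrite (le_anti (_ : u <= v <= u)) ?subrr// uv.
rewrite /arclen Rintegral_itvB; last 3 first.
- exact: int.
- by rewrite bnd_simp.
- by rewrite bnd_simp.
rewrite -muE -!(@Rintegral_cst _ _ _ lebesgue_measure `]u, v])//.
apply/andP; split; apply: le_Rintegral => //= x; rewrite in_itv/= => /andP[ux xv].
  by apply: speed_le; lra.
by apply: speed_le; lra.
Qed.

End slope_function.

Section u_gamma.
Variables (g : R -> R) (k0 k1 k2 : R).
Hypothesis gk : regular_slope (derI g) (derI (derI g)) k0 k1 k2.
Local Notation s := (derI g).

Lemma u_gamma_slope u : 0 <= u <= 1 -> u_gamma g (s u)%:E = u.
Proof.
move=> /andP[u0 u1]; rewrite /u_gamma /slope0 /slope1 !lee_fin.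
rewrite !(slope_leE gk) ?lexx ?ler01 ?u0 ?u1//.
case: ifPn => [u00|_]; first by apply/eqP; rewrite eq_le u0 u00.
case: ifPn => [u11|_]; first by apply/eqP; rewrite eq_le u1 u11.
rewrite /= pinvKV//; last by rewrite inE/= in_itv/= u0.
move=> x y; rewrite !inE/= !in_itv/= => xI yI sxy.
by apply/eqP; rewrite eq_le -(slope_leE gk xI yI) -(slope_leE gk yI xI) sxy lexx.
Qed.

Lemma u_gamma_in t : s 0 <= t <= s 1 ->
  0 <= u_gamma g t%:E <= 1 /\ s (u_gamma g t%:E) = t.
Proof.
move=> t01; have [u u01 <-] := slope_IVT gk t01.
by rewrite u_gamma_slope.
Qed.

(** What the selection of edges by slope needs of the truncated inverse. The guards allow for slopes
    below g'(0), where w = 0, and above g'(1), including +oo, where w = 1. *)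
Lemma u_gammaP (t : \bar R) : (0 <= t)%E -> let w := u_gamma g t in
  [/\ 0 <= w <= 1, 0 < w -> ((s w)%:E <= t)%E & w < 1 -> (t <= (s w)%:E)%E].
Proof.
move=> t0; rewrite /= /u_gamma /slope0 /slope1.
case: ifPn => [t00|]; first by split; rewrite ?lexx ?ler01 ?ltxx.
rewrite -ltNge => t00.
case: ifPn => [t11|]; first by split; rewrite ?lexx ?ler01 ?ltxx.
rewrite -ltNge => t11; case: t t0 t00 t11 => [t| |]//= _; rewrite !lte_fin => t0 t1.
have t01 : s 0 <= t <= s 1 by rewrite !ltW.
have [u01 us] := u_gamma_in t01.
move: u01 us; rewrite /u_gamma /slope0 /slope1 !lee_fin !leNgt t0 t1 /=.
by move=> u01 ->; split => // _; rewrite ltxx.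
Qed.

End u_gamma.

End convex_curve.
(** * Cones of slopes and the scaling limit *)

Section cones.
Variable R : realType.
Implicit Types (a b rho : R) (cl : bool).

(* Lattice points (q, p) with rho * p / q in [a, b[, or in [a, b] if [cl]. *)
Definition cone rho a b cl : set (nat * nat) :=
  [set y | [/\ (0 < y.1)%N, a * y.1%:R <= rho * y.2%:R &
            if cl then rho * y.2%:R <= b * y.1%:R else rho * y.2%:R < b * y.1%:R]].

Lemma absz_ceil_le (r : R) (p : nat) : 0 <= r ->
  (`|Num.ceil r|%N <= p)%N = (r <= p%:R).
Proof.
move=> r0; have c0 : 0 <= Num.ceil r.
  by rewrite -(ler_int R) (le_trans r0)// ceil_ge.
by rewrite -lez_nat gez0_abs// -[p%:R]/(p%:Z%:~R) -ceil_le_int.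
Qed.

Lemma absz_ceil_itv (r : R) : 0 <= r ->
  r <= (`|Num.ceil r|%N)%:R < r + 1.
Proof.
move=> r0; rewrite -absz_ceil_le// leqnn/=.
case e : `|Num.ceil r|%N => [|m]; first by rewrite ltr_wpDl.
have : ~~ (`|Num.ceil r|%N <= m)%N by rewrite e -ltnNge.
by rewrite absz_ceil_le// -ltNge -natr1 ltrD2r.
Qed.

Lemma cone_sector rho a b cl : 0 < rho -> 0 <= a -> a <= b ->
  is_sector (cone rho a b cl) ((b - a) / rho).
Proof.
move=> rho0 a0 ab; split.
- move=> k q p; rewrite /cone/= !natrM !(mulrCA _ k.+1%:R) !ler_pM2l ?ltr0n//.
  by rewrite !ltr_pM2l ?ltr0n// muln_gt0.
- by move=> q p [].
exists (fun q => `|Num.ceil (a * q%:R / rho)|%N).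
(* Column q holds the integers from a q / rho to b q / rho. The exclusive upper index is the floor
   plus 1 when the right end belongs to the cone and the ceiling otherwise; either is within 1 of b
   q / rho. *)
exists (fun q => if cl then (Num.truncn (b * q%:R / rho)).+1
                 else `|Num.ceil (b * q%:R / rho)|%N) => q q0.
have qR : 0 < q%:R :> R by rewrite ltr0n.
have aq : 0 <= a * q%:R / rho by rewrite divr_ge0 ?mulr_ge0// ltW.
have bq : 0 <= b * q%:R / rho.
  by rewrite divr_ge0 ?(ltW rho0)// mulr_ge0// (le_trans a0).
have abq : a * q%:R / rho <= b * q%:R / rho.
  by rewrite ler_pM2r ?invr_gt0// ler_pM2r.
have lamE : (b - a) / rho * q%:R = b * q%:R / rho - a * q%:R / rho.
  by field; rewrite gt_eqF.
have /andP[ca ca1] := absz_ceil_itv aq.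
have /andP[cb cb1] := absz_ceil_itv bq.
have tb := truncnS_gt (b * q%:R / rho).
have tb' : (Num.truncn (b * q%:R / rho))%:R <= b * q%:R / rho by rewrite truncn_le.
split.
- move=> p; rewrite /cone/= absz_ceil_le// ler_pdivrMr// [p%:R * rho]mulrC.
  case: cl.
    rewrite ltnS truncn_ge_nat// ler_pdivlMr// [p%:R * rho]mulrC.
    by split => [[_ -> ->]|/andP[-> ->]].
  rewrite (ltnNge p) absz_ceil_le// -ltNge ltr_pdivlMr// [p%:R * rho]mulrC.
  by split => [[_ -> ->]|/andP[-> ->]].
- case: cl.
    by rewrite -ltnS -(ltr_nat R) -natr1; move: tb; rewrite -natr1; lra.
  by rewrite absz_ceil_le// (le_trans abq).
- rewrite lamE ler_norml; case: cl.
    by move: tb; rewrite -natr1 => tb; apply/andP; split; lra.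
  by apply/andP; split; lra.
Qed.

Lemma powR_third_cube (b : R) : 0 <= b -> (b `^ (1 / 3)) ^+ 3 = b.
Proof. by move=> b0; rewrite -powR_mulrn ?powR_ge0// -powRrM div1r mulVf// powRr1. Qed.

Lemma bose_weight_le (y y' : R) : 0 < y -> y <= y' ->
  (expR y' - 1)^-1 <= (expR y - 1)^-1.
Proof.
move=> y0 yy; rewrite lef_pV2 ?posrE ?subr_gt0 ?expR_gt1//.
  by rewrite lerD2r ler_expR.
exact: lt_le_trans yy.
Qed.

(* Variance of a geometric variable with parameter exp(-y), up to a factor 1/y. *)
Lemma geom_variance_le (y : R) : 0 < y ->
  expR (- y) / (1 - expR (- y)) ^+ 2 <= 2 / y * (expR (y / 2) - 1)^-1.
Proof.
(* With w = e^(y/2) the left side is w^2 / ((w - 1)^2 (w + 1)^2), and y / 2 <= w - 1 and w <= w + 1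
   conclude. A weight at the half scale lets the variances be summed by [bose_sum]. *)
move=> y0; pose w := expR (y / 2).
have wE : expR (- y) = (w ^+ 2)^-1.
  by rewrite expRN /w -expRM_natr divfK// pnatr_eq0.
have w1 : 1 + y / 2 <= w by rewrite expR_ge1Dx.
have w10 : 0 < w - 1 by lra.
have w0 : 0 < w by lra.
rewrite wE -[expR (y / 2)]/w.
have -> : (w ^+ 2)^-1 / (1 - (w ^+ 2)^-1) ^+ 2 =
    w ^+ 2 / ((w - 1) ^+ 2 * (w + 1) ^+ 2).
  field; rewrite !gt_eqF//; last by rewrite addr_gt0.
  by rewrite subr_gt0 exprn_egt1//; lra.
have -> : 2 / y * (w - 1)^-1 = 2 / (y * (w - 1)).
  by field; rewrite !gt_eqF.
have p1 : 0 < w + 1 by rewrite addr_gt0.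
rewrite ler_pdivrMr; last by rewrite mulr_gt0// exprn_gt0.
rewrite mulrAC ler_pdivlMr ?mulr_gt0//.
have : w ^+ 2 * (y * (w - 1)) <= w ^+ 2 * (2 * (w - 1) * (w - 1)).
  by rewrite ler_pM2l ?exprn_gt0// ler_pM2r//; lra.
move/le_trans; apply.
have -> : w ^+ 2 * (2 * (w - 1) * (w - 1)) = 2 * (w - 1) ^+ 2 * w ^+ 2.
  by ring.
rewrite -mulrA ler_pM2l// ler_pM2l ?exprn_gt0// lerXn2r ?nnegrE//; lra.
Qed.

End cones.

(** * The limit n_1, n_2 -> oo and the normalisation of Bose sums *)

Section scaling_limit.
Variables (R : realType) (c : R).
Hypothesis c0 : 0 < c.
Local Notation rho n := (c * n.1%:R / n.2%:R).
Local Notation alpha n := ((rho n * n.1%:R) `^ (- (1 / 3))).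

Lemma n_infty_ge (M : R) :
  \forall n \near n_infty c, M <= n.1%:R /\ (0 < n.1)%N /\ (0 < n.2)%N.
Proof.
exists (Num.truncn M).+1, 1; split=> // n n1 n2 _; split; last first.
  by split; exact: leq_trans n1 || exact: leq_trans n2.
apply: le_trans (ltW (truncnS_gt M)) _.
by rewrite ler_nat.
Qed.

Lemma rho_cvg : (fun n : nat * nat => rho n) @ n_infty c --> (1 : R).
Proof.
have h : (fun n : nat * nat => n.2%:R / n.1%:R : R) @ n_infty c --> c.
  apply/cvgrPdist_lt => e e0; exists 0%N, e; split => // n _ _.
  by rewrite distrC.
have -> : (fun n : nat * nat => rho n) =
    (fun n : nat * nat => c * (n.2%:R / n.1%:R)^-1).
  by apply/funext => n; rewrite invf_div mulrA.
have := cvgM (cvg_cst c) (cvgV (lt0r_neq0 c0) h).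
by rewrite divff ?lt0r_neq0//; apply.
Qed.

Lemma rho_near (d : R) : 0 < d -> \forall n \near n_infty c, `|rho n - 1| <= d.
Proof.
move=> d0; have /cvgrPdist_le/(_ d d0) := rho_cvg.
by apply: filterS => n; rewrite distrC.
Qed.

(** The identity rho alpha^3 = 1 / n_1 converts the order h^-3 of the lattice sums, with h
    proportional to alpha, into n_1. *)
Lemma alpha_cube (n : nat * nat) : (0 < n.1)%N -> (0 < n.2)%N ->
  [/\ 0 < rho n, 0 < alpha n & rho n * alpha n ^+ 3 = n.1%:R^-1].
Proof.
move=> n1 n2; have r0 : 0 < rho n by rewrite divr_gt0 ?mulr_gt0// ltr0n.
have rn : 0 < rho n * n.1%:R by rewrite mulr_gt0// ltr0n.
split => //; first by rewrite powR_gt0.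
rewrite powRN exprVn powR_third_cube ?ltW// invfM mulrA divff ?mul1r//.
by rewrite gt_eqF.
Qed.

Lemma alpha_near (d : R) : 0 < d ->
  \forall n \near n_infty c, 0 < alpha n < d.
Proof.
move=> d0; have d30 : 0 < d ^+ 3 by rewrite exprn_gt0.
near=> n.
have [nM [n1 n2]] : (3 / d ^+ 3 <= n.1%:R) /\ (0 < n.1)%N /\ (0 < n.2)%N.
  by near: n; exact: n_infty_ge.
have [r0 a0 a3] := alpha_cube n1 n2.
have r12 : 1 / 2 <= rho n.
  have : `|rho n - 1| <= 1 / 2 by near: n; apply: rho_near.
  by rewrite ler_norml => /andP[? ?]; lra.
rewrite a0 /=.
have n0 : 0 < n.1%:R :> R by rewrite ltr0n.
have : rho n * alpha n ^+ 3 * n.1%:R = 1 by rewrite a3 mulVf// gt_eqF.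
rewrite ler_pdivrMr// in nM.
move=> h; rewrite ltNge; apply/negP => da.
have : 1 / 2 * d ^+ 3 <= rho n * alpha n ^+ 3.
  by rewrite ler_pM ?(ltW d30)// lerXn2r ?nnegrE ?(ltW d0) ?(ltW a0).
move=> /(ler_wpM2r (ltW n0)); rewrite h; lra.
Unshelve. all: by end_near. Qed.

(** As lam = (b - a) / rho, the identity rho alpha^3 = 1 / n_1 cancels rho, and the factor kappa^3
    of h^3 cancels the one in the asymptotics: kappa is chosen for this. *)
Lemma bose_cone_limit (a b cl : _) (k eta : R) : 0 <= a -> a <= b -> 0 < k ->
  0 < eta -> \forall n \near n_infty c,
  exists2 W, bose_sum (cone (rho n) a b cl) (alpha n * (kappa R * k `^ (1 / 3))) = W%:E &
    `|n.1%:R^-1 * W - (b - a) / k| <= eta.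
Proof.
move=> a0 ab k0 eta0; have kap0 := kappa_gt0 R.
have kap3 : 0 < kappa R ^+ 3 by rewrite exprn_gt0.
(* The width (b - a) / rho depends on n; rho >= 1/2 bounds it by 2 (b - a), and the asymptotics are
   uniform up to that bound. *)
have M0 : 0 <= 2 * (b - a) by rewrite mulr_ge0// subr_ge0.
(* The error is multiplied in the end by rho / (kappa^3 k), at most 2 / (kappa^3 k). *)
have e0 : 0 < eta * (kappa R ^+ 3 * k) / 2 by rewrite divr_gt0// !mulr_gt0.
have [h0 h00 hb] := bose_sum_asymptotics M0 e0.
have f0 : 0 < kappa R * k `^ (1 / 3) by rewrite mulr_gt0// powR_gt0.
near=> n.
have [_ [n1 n2]] : (0 <= n.1%:R :> R) /\ (0 < n.1)%N /\ (0 < n.2)%N.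
  by near: n; exact: n_infty_ge.
have [r0 al0 a3] := alpha_cube n1 n2.
have /andP[r12 r2] : 1 / 2 <= rho n <= 2.
  have : `|rho n - 1| <= 1 / 2 by near: n; apply: rho_near.
  by rewrite ler_norml => /andP[? ?]; apply/andP; split; lra.
have /andP[_ ah] : 0 < alpha n < h0 / (kappa R * k `^ (1 / 3)).
  by near: n; apply: alpha_near; rewrite divr_gt0.
have lam : 0 <= (b - a) / rho n <= 2 * (b - a).
  rewrite divr_ge0 ?subr_ge0 ?(ltW r0)//= ler_pdivrMr//.
  have ba : 0 <= b - a by rewrite subr_ge0.
  have := ler_wpM2l ba r12; lra.
have [|W WE Wb] := hb _ _ (alpha n * (kappa R * k `^ (1 / 3)))
  (cone_sector cl r0 a0 ab) lam.
  by rewrite mulr_gt0//= -ltr_pdivlMr.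
exists W => //.
have h3 : (alpha n * (kappa R * k `^ (1 / 3))) ^+ 3 = alpha n ^+ 3 * (kappa R ^+ 3 * k).
  by rewrite exprMn [X in _ * X = _]exprMn (powR_third_cube (ltW k0)).
rewrite h3 in Wb.
have K0 : 0 < kappa R ^+ 3 * k by rewrite mulr_gt0.
have -> : n.1%:R^-1 * W - (b - a) / k = rho n / (kappa R ^+ 3 * k) *
    (alpha n ^+ 3 * (kappa R ^+ 3 * k) * W - kappa R ^+ 3 * ((b - a) / rho n)).
  have key (r A K d : R) : r != 0 -> K != 0 ->
      r * A * W - d / k = r / (K * k) * (A * (K * k) * W - K * (d / r)).
    by move=> r1 K1; field; rewrite r1 K1 lt0r_neq0.
  by rewrite -a3 (key _ _ (kappa R ^+ 3)) ?lt0r_neq0.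
have q0 : 0 <= rho n / (kappa R ^+ 3 * k) by apply: divr_ge0; exact: ltW.
rewrite normrM (ger0_norm q0).
apply: (@le_trans _ _ (2 / (kappa R ^+ 3 * k) * (eta * (kappa R ^+ 3 * k) / 2))).
  by apply: ler_pM Wb => //; rewrite ler_pM2r ?invr_gt0.
by rewrite le_eqVlt; apply/orP; left; apply/eqP; field; rewrite !gt_eqF.
Unshelve. all: by end_near. Qed.

End scaling_limit.
(** * Means and variances over a cone *)

Section gamma_sums.
Variables (R : realType) (g : R -> R) (k0 k1 k2 : R).
Hypothesis gk : regular_slope (derI g) (derI (derI g)) k0 k1 k2.
Hypothesis c0 : 0 < c_gamma g.
Local Notation s := (derI g).
Local Notation k := (derI (derI g)).
Local Notation inv_slope n x :=
  (u_gamma g (rho g n * (dir2 x)%:R / (dir1 x)%:R)%:E).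
Implicit Types (n : nat * nat) (x : direction).

Lemma bose_weight_ge0 (y : R) : 0 <= y -> 0 <= (expR y - 1)^-1.
Proof. by move=> y0; rewrite invr_ge0 subr_ge0 -expR0 ler_expR. Qed.

Lemma rho_alpha n : (0 < n.1)%N -> (0 < n.2)%N ->
  [/\ 0 < rho g n, 0 < alpha g n & rho g n * alpha g n ^+ 3 = n.1%:R^-1].
Proof. exact: alpha_cube. Qed.

Lemma direction_neq0 x : dir1 x = 0%N -> dir2 x <> 0%N.
Proof.
by case: x => -[q p] cop; rewrite /dir1 /dir2 /= => q0 p0; move: cop; rewrite q0 p0.
Qed.

Lemma cone_slope n x (a b : R) cl : cone (rho g n) a b cl (val x) ->
  a <= rho g n * (dir2 x)%:R / (dir1 x)%:R <= b.
Proof.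
move=> [q0 aq qb]; have q0R : 0 < (dir1 x)%:R :> R by rewrite ltr0n.
rewrite ler_pdivlMr// ler_pdivrMr// aq /=.
by move: qb; case: cl => // /ltW.
Qed.

(** With t = rho x_2 / x_1 the exponent is alpha delta_1 (x_1 + rho x_2 / c), and x_1 + rho x_2 / c
    = x_1 (c + t) / c cancels the factor c / (c + t). The factor sqrt(1 + t^2) cancels the
    denominator in the cube root of the curvature, so only g''(u)^(1/3) remains. *)
Lemma zpow_in n x : (0 < n.1)%N -> (0 < n.2)%N ->
  cone (rho g n) (s 0) (s 1) true (val x) ->
  [/\ 0 <= inv_slope n x <= 1,
      s (inv_slope n x) = rho g n * (dir2 x)%:R / (dir1 x)%:R &
      zpow g n x = expR (- (alpha g n * (kappa R * k (inv_slope n x) `^ (1 / 3))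
                             * (dir1 x)%:R))].
Proof.
move=> n1 n2 xS; have [q0 _ _] := xS.
have q0R : 0 < (dir1 x)%:R :> R by rewrite ltr0n.
have tI := cone_slope xS; have [uI us] := u_gamma_in gk tI.
split => //; have [r0 al0 _] := rho_alpha n1 n2.
set t := rho g n * (dir2 x)%:R / (dir1 x)%:R in tI uI us *.
have t0 : 0 <= t.
  by rewrite /t divr_ge0 ?mulr_ge0 ?(ltW q0R)// ltW.
set u := u_gamma g t%:E in uI us *.
have ku0 : 0 < k u.
  by have /andP[/(lt_le_trans (rs_k0 gk))] := rs_bound gk uI.
have tauE : tau_tilde g n x = t%:E by rewrite /tau_tilde /slope gt_eqF.
have dE : delta1_fin g t = kappa R * k u `^ (1 / 3) * (c_gamma g / (c_gamma g + t)).
  rewrite /delta1_fin /curv_gamma -/u powRM ?powR_ge0 ?(ltW ku0)//.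
  have t1 : 0 < 1 + t ^+ 2 by rewrite ltr_wpDr ?sqr_ge0.
  rewrite -powRrM (_ : - (3 / 2) * (1 / 3) = - 2^-1); last by field.
  rewrite powRN powR12_sqrt ?(ltW t1)//.
  have sq0 : Num.sqrt (1 + t ^+ 2) != 0 by rewrite gt_eqF// sqrtr_gt0.
  have ct : c_gamma g + t != 0 by rewrite gt_eqF// ltr_wpDr.
  by field; rewrite sq0 ct.
have z1E : z1 g n x = expR (- (alpha g n * delta1_fin g t)).
  by rewrite /z1 /delta1 tauE /slope0 /slope1 !lee_fin tI.
have z2E : z2 g n x = expR (- (alpha g n * rho g n * (delta1_fin g t / c_gamma g))).
  by rewrite /z2 /delta2 tauE /slope0 /slope1 !lee_fin tI.
rewrite /zpow z1E z2E -!expRM_natr -expRD dE; congr expR.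
rewrite /t; set q := (dir1 x)%:R in q0R *; set p := (dir2 x)%:R.
have cq : c_gamma g * q + rho g n * p != 0.
  by rewrite gt_eqF// ltr_wpDr ?mulr_gt0// mulr_ge0 ?(ltW r0) /p.
have c0' := lt0r_neq0 c0; have q0' := lt0r_neq0 q0R.
have ct : c_gamma g + rho g n * p / q != 0.
  by rewrite gt_eqF// ltr_wpDr// divr_ge0 ?mulr_ge0 ?(ltW q0R) ?(ltW r0)// /p.
have key (r al c q' p' f : R) : c != 0 -> q' != 0 -> c * q' + r * p' != 0 ->
    c + r * p' / q' != 0 ->
    - (al * (f * (c / (c + r * p' / q')))) * q' +
    - (al * r * (f * (c / (c + r * p' / q')) / c)) * p' = - (al * f * q').
  by move=> h1 h2 h3 _; field; rewrite h1 h2 h3.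
exact: key.
Qed.

(** Off the range of slopes both deltas are +oo and z_1 = z_2 = 0; since a direction has a nonzero
    coordinate, the convention 0^0 = 1 does not make the product 1. *)
Lemma zpow_out n x : (0 < n.1)%N -> (0 < n.2)%N ->
  ~ cone (rho g n) (s 0) (s 1) true (val x) -> zpow g n x = 0.
Proof.
move=> n1 n2 xS; have [r0 al0 _] := rho_alpha n1 n2.
have out : ((slope0 g)%:E <= tau_tilde g n x <= (slope1 g)%:E)%E = false.
  apply/negP; rewrite /tau_tilde /slope pnatr_eq0 /slope0 /slope1.
  case: eqP => q0; first by rewrite andbC.
  rewrite !lee_fin => tI; apply: xS.
  have q0' : (0 < dir1 x)%N by rewrite lt0n; apply/eqP.
  have q0R : 0 < (dir1 x)%:R :> R by rewrite ltr0n.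
  by move: tI; rewrite ler_pdivlMr// ler_pdivrMr// => /andP[h1 h2]; split.
have z1E : z1 g n x = 0.
  by rewrite /z1 /delta1 out gt0_muley ?lte_fin.
have z2E : z2 g n x = 0.
  by rewrite /z2 /delta2 out gt0_muley ?lte_fin// mulr_gt0.
rewrite /zpow z1E z2E !expr0n.
case: eqP => [/direction_neq0|]; last by rewrite mul0r.
by case: eqP => //; rewrite mulr0.
Qed.

Lemma zpow_itv n x : (0 < n.1)%N -> (0 < n.2)%N -> 0 <= zpow g n x < 1.
Proof.
move=> n1 n2; have [xS|xS] := pselect (cone (rho g n) (s 0) (s 1) true (val x)).
  have [uI _ ->] := zpow_in n1 n2 xS; have [q0 _ _] := xS.
  have ku0 : 0 < k (inv_slope n x).
    by have /andP[/(lt_le_trans (rs_k0 gk))] := rs_bound gk uI.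
  have [r0 al0 _] := rho_alpha n1 n2.
  rewrite expR_ge0 expR_lt1 oppr_lt0 mulr_gt0 ?ltr0n// mulr_gt0//.
  by rewrite mulr_gt0 ?kappa_gt0// powR_gt0.
by rewrite zpow_out// lexx ltr01.
Qed.

Lemma enorm_cone n x (a b : R) cl : (0 < n.1)%N -> (0 < n.2)%N -> 0 <= a ->
  cone (rho g n) a b cl (val x) ->
  (dir1 x)%:R * Num.sqrt (1 + (a / rho g n) ^+ 2) <= enorm R x <=
  (dir1 x)%:R * Num.sqrt (1 + (b / rho g n) ^+ 2).
Proof.
move=> n1 n2 a0 xS; have [q0 _ _] := xS.
have q0R : 0 < (dir1 x)%:R :> R by rewrite ltr0n.
have [r0 _ _] := rho_alpha n1 n2.
have /andP[ta tb] := cone_slope xS.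
set t := _ / _ in ta tb.
have -> : enorm R x = (dir1 x)%:R * Num.sqrt (1 + (t / rho g n) ^+ 2).
  rewrite -{1}(ger0_norm (ltW q0R)) -sqrtr_sqr -sqrtrM ?sqr_ge0//.
  rewrite /enorm /t; congr Num.sqrt.
  move: (rho g n) (dir1 x)%:R (dir2 x)%:R (lt0r_neq0 r0) (lt0r_neq0 q0R).
  by move=> ? ? ? h1 h2; field; rewrite h1 h2.
have mono y z : 0 <= y -> y <= z ->
    Num.sqrt (1 + (y / rho g n) ^+ 2) <= Num.sqrt (1 + (z / rho g n) ^+ 2).
  move=> y0 yz; rewrite ler_sqrt ?addr_ge0 ?sqr_ge0// lerD2l.
  have y1 : 0 <= y / rho g n by apply: divr_ge0 => //; exact: ltW.
  have yz1 : y / rho g n <= z / rho g n by rewrite ler_pM2r ?invr_gt0.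
  by rewrite lerXn2r ?nnegrE// (le_trans y1).
by rewrite !ler_pM2l// !mono// (le_trans a0).
Qed.

Lemma cone_sub n (v v' : R) cl y : 0 <= v -> v <= v' -> v' <= 1 ->
  cone (rho g n) (s v) (s v') cl y -> cone (rho g n) (s 0) (s 1) true y.
Proof.
move=> v0 vv v1 [q0 qa qb]; split => //.
  apply: le_trans qa; rewrite ler_wpM2r//.
  by apply: (slope_le gk) => //; apply: le_trans vv v1.
apply: (@le_trans _ _ (s v' * y.1%:R)); first by case: cl qb => // /ltW.
by rewrite ler_wpM2r//; apply: (slope_le gk) => //; apply: le_trans v0 vv.
Qed.

Lemma mean_weightE (y : R) : 0 < y ->
  expR (- y) / (1 - expR (- y)) = (expR y - 1)^-1.
Proof.
move=> y0; rewrite expRN; have : expR y - 1 != 0 by rewrite gt_eqF// subr_gt0 expR_gt1.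
by move=> h; field; rewrite h gt_eqF// expR_gt0.
Qed.

(** A larger g'' means a larger exponent and a smaller mean, so freezing it at [hi] bounds from
    below and at [lo] from above. The square roots divide by rho because the edge x has slope tau(x)
    = tau(x~) / rho. *)
Lemma cone_sum_bounds n (v v' lo hi : R) cl : (0 < n.1)%N -> (0 < n.2)%N ->
  0 <= v -> v <= v' -> v' <= 1 -> 0 < lo ->
  (forall u, v <= u <= v' -> lo <= k u <= hi) ->
  let S := cone (rho g n) (s v) (s v') cl in
  let E := (\esum_(x in prim S)
     (enorm R x * (zpow g n x / (1 - zpow g n x)))%:E)%E in
  ((Num.sqrt (1 + (s v / rho g n) ^+ 2))%:E *
     bose_sum S (alpha g n * (kappa R * hi `^ (1 / 3))) <= E)%E /\
  (E <= (Num.sqrt (1 + (s v' / rho g n) ^+ 2))%:E *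
     bose_sum S (alpha g n * (kappa R * lo `^ (1 / 3))))%E.
Proof.
move=> n1 n2 v0 vv v1 lo0 klh S E; have [r0 al0 _] := rho_alpha n1 n2.
have kap0 := kappa_gt0 R.
have w0 (f q : R) : 0 <= f -> 0 <= q ->
    (0 <= (q / (expR (alpha g n * (kappa R * f) * q) - 1))%:E)%E.
  move=> f0 q0; rewrite lee_fin mulr_ge0// bose_weight_ge0//.
  by rewrite !mulr_ge0// ltW.
have main x : prim S x -> exists2 f, lo `^ (1/3) <= f <= hi `^ (1/3) &
    zpow g n x / (1 - zpow g n x) =
    (expR (alpha g n * (kappa R * f) * (dir1 x)%:R) - 1)^-1.
  move=> xS; have xS' := cone_sub v0 vv v1 xS; have [q0 _ _] := xS.
  have [uI us ->] := zpow_in n1 n2 xS'.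
  exists (k (inv_slope n x) `^ (1 / 3)).
    have /andP[vu uv] := cone_slope xS.
    have vI : 0 <= v <= 1 by rewrite v0 (le_trans vv).
    have vI' : 0 <= v' <= 1 by rewrite (le_trans v0).
    rewrite -us (slope_leE gk vI uI) in vu.
    rewrite -us (slope_leE gk uI vI') in uv.
    have /andP[kl kh] := klh _ (introT andP (conj vu uv)).
    have lk := lt_le_trans lo0 kl.
    have pw (y z : R) : 0 < y -> y <= z -> y `^ (1 / 3) <= z `^ (1 / 3).
      move=> y0 yz; apply: ge0_ler_powR => //; rewrite nnegrE ltW//.
      exact: lt_le_trans yz.
    by rewrite !pw.
  have ku0 : 0 < k (inv_slope n x).
    by have /andP[/(lt_le_trans (rs_k0 gk))] := rs_bound gk uI.
  by rewrite mean_weightE// mulr_gt0 ?ltr0n// mulr_gt0// mulr_gt0// powR_gt0.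
have lo30 : 0 < lo `^ (1 / 3) by rewrite powR_gt0.
split.
- rewrite /bose_sum -esumZl ?sqrtr_ge0//; last first.
    by move=> x _; apply: w0; rewrite ?powR_ge0.
  apply: le_esum => x xS; rewrite -EFinM lee_fin.
  have [f /andP[f1 f2] ->] := main x xS.
  have q0 : (0 < dir1 x)%N by case: xS.
  have q0R : 0 < (dir1 x)%:R :> R by rewrite ltr0n.
  have sv0 : 0 <= s v by apply: (slope_nonneg gk); rewrite v0 (le_trans vv).
  have /andP[e1 _] := enorm_cone n1 n2 sv0 xS.
  rewrite [leLHS]mulrA; have f0 := lt_le_trans lo30 f1.
  have b0 : 0 < alpha g n * (kappa R * f) * (dir1 x)%:R.
    by rewrite mulr_gt0// mulr_gt0// mulr_gt0.
  have bb : alpha g n * (kappa R * f) * (dir1 x)%:R <=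
      alpha g n * (kappa R * hi `^ (1 / 3)) * (dir1 x)%:R.
    by rewrite ler_pM2r// ler_pM2l// ler_pM2l.
  apply: ler_pM (bose_weight_le b0 bb).
  + by rewrite mulr_ge0 ?sqrtr_ge0.
  + by apply: bose_weight_ge0; rewrite (le_trans (ltW b0)).
  + by rewrite mulrC.
- rewrite /bose_sum -esumZl ?sqrtr_ge0//; last first.
    by move=> x _; apply: w0; rewrite ?powR_ge0.
  apply: le_esum => x xS; rewrite -EFinM lee_fin.
  have [f /andP[f1 f2] ->] := main x xS.
  have q0 : (0 < dir1 x)%N by case: xS.
  have q0R : 0 < (dir1 x)%:R :> R by rewrite ltr0n.
  have sv0 : 0 <= s v by apply: (slope_nonneg gk); rewrite v0 (le_trans vv).
  have /andP[_ e1] := enorm_cone n1 n2 sv0 xS.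
  rewrite [leRHS]mulrA; have f0 := lt_le_trans lo30 f1.
  have b0 : 0 < alpha g n * (kappa R * lo `^ (1 / 3)) * (dir1 x)%:R.
    by rewrite mulr_gt0// mulr_gt0// mulr_gt0.
  have bb : alpha g n * (kappa R * lo `^ (1 / 3)) * (dir1 x)%:R <=
      alpha g n * (kappa R * f) * (dir1 x)%:R.
    by rewrite ler_pM2r// ler_pM2l// ler_pM2l.
  apply: ler_pM (bose_weight_le b0 bb).
  + by rewrite sqrtr_ge0.
  + by apply: bose_weight_ge0; rewrite (le_trans (ltW b0)).
  + by rewrite mulrC.
Qed.

(** * Mean length on a cone against arc length on a cell *)

Lemma sqrt1_lip (x y : R) :
  Num.sqrt (1 + x ^+ 2) <= Num.sqrt (1 + y ^+ 2) + `|x - y|.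
Proof.
have y1 : 0 <= 1 + y ^+ 2 by rewrite addr_ge0 ?sqr_ge0.
have ysq : `|y| <= Num.sqrt (1 + y ^+ 2).
  by rewrite -sqrtr_sqr ler_sqrt// lerDr.
have r0 : 0 <= Num.sqrt (1 + y ^+ 2) + `|x - y| by rewrite addr_ge0 ?sqrtr_ge0.
rewrite -[leRHS]ger0_norm// -sqrtr_sqr ler_sqrt ?sqr_ge0//.
rewrite sqrrD sqr_sqrtr// real_normK ?num_real//.
have h1 : `|y| * `|x - y| <= Num.sqrt (1 + y ^+ 2) * `|x - y| by rewrite ler_wpM2r.
have h2 : y * (x - y) <= `|y| * `|x - y| by rewrite -normrM ler_norm.
rewrite mulr2n; nra.
Qed.

Lemma sqrt_rho_near (a e : R) : 0 < e -> \forall n \near n_infty (c_gamma g),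
  `|Num.sqrt (1 + (a / rho g n) ^+ 2) - Num.sqrt (1 + a ^+ 2)| <= e.
Proof.
move=> e0; have h : (fun n => a / rho g n) @ n_infty (c_gamma g) --> a.
  have := cvgM (cvg_cst a) (cvgV (oner_neq0 R) (rho_cvg c0)).
  by rewrite invr1 mulr1; apply.
move/cvgrPdist_le : h => /(_ e e0); apply: filterS => n hn.
have := sqrt1_lip (a / rho g n) a; have := sqrt1_lip a (a / rho g n).
by rewrite distrC in hn; rewrite distrC => h1 h2; rewrite ler_norml; apply/andP; split; lra.
Qed.

Lemma speed_rho_near (u e : R) : 0 < e -> \forall n \near n_infty (c_gamma g),
  `|Num.sqrt (1 + (s u / rho g n) ^+ 2) - speed s u| <= e.
Proof. exact: sqrt_rho_near. Qed.

(** Coefficient of the squared cell width in the error on a cell: k1 comes from the variation of the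
    speed, at most that of the slope, and the other term from freezing g'' in a window of size 2 k2
    times the width. *)
Definition mesh_const : R := k1 + 2 * k2 * speed s 1 / k0.

Lemma slope_quotient (lo hi l D e : R) : 0 < k0 -> k0 <= lo -> lo <= hi ->
  hi - lo <= e -> 0 <= l -> lo * l <= D -> D <= hi * l ->
  [/\ 0 <= D / hi, D / lo <= l + e * l / k0 & l - e * l / k0 <= D / hi].
Proof.
move=> k00 k0lo lohi he l0 Dl Dh.
have lo0 : 0 < lo by apply: lt_le_trans k0lo.
have hi0 : 0 < hi by apply: lt_le_trans lohi.
have el : (hi - lo) * l <= e * l by rewrite ler_wpM2r.
have el0 : 0 <= e * l by rewrite (le_trans _ el)// mulr_ge0// subr_ge0.
split; first by rewrite divr_ge0 ?(ltW hi0)// (le_trans _ Dl)// mulr_ge0// ltW.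
- apply: (@le_trans _ _ (l + e * l / lo)).
    by rewrite ler_pdivrMr// mulrDl mulfVK ?lt0r_neq0//; move: el Dh; clear; lra.
  by rewrite lerD2l ler_wpM2l// lef_pV2.
- apply: (@le_trans _ _ (l - e * l / hi)).
    by rewrite lerD2l lerN2 ler_wpM2l// lef_pV2// (le_trans k0lo).
  by rewrite ler_pdivlMr// mulrBl mulfVK ?lt0r_neq0//; move: el Dl; clear; lra.
Qed.

(** In use, l is the width of a cell, a and b are the speeds at its ends, A its arc length, D the
    increment of slope, and q, q' that increment divided by [lo] and by [hi]. *)
Lemma mesh_arith (l e a b S D A q q' : R) : 0 <= l -> 0 <= e -> 0 <= a ->
  a <= b -> b <= S -> b <= a + D -> D <= k1 * l ->
  a * l <= A -> A <= b * l -> q <= l + e -> l - e <= q' ->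
  b * q <= A + (k1 * l * l + S * e) /\ A <= a * q' + (k1 * l * l + S * e).
Proof.
move=> l0 e0 a0 ab bS bD Dl al bl ql ql'.
have h1 : b * q <= b * (l + e) by rewrite ler_wpM2l// (le_trans a0).
have h2 : a * (l - e) <= a * q' by rewrite ler_wpM2l.
have h3 : b * l <= (a + k1 * l) * l by rewrite ler_wpM2r// (le_trans bD)// lerD2l.
have h4 : b * e <= S * e by rewrite ler_wpM2r.
have h5 : a * e <= b * e by rewrite ler_wpM2r.
by split; move: al bl h1 h2 h3 h4 h5; clear; lra.
Qed.

(** The Lipschitz constant gives the window k(v) +- k2 (v' - v), cut off below at k0 so that [lo]
    remains a positive divisor. *)
Lemma curvature_window (v v' : R) : 0 <= v -> v <= v' -> v' <= 1 ->
  exists lo hi : R, [/\ k0 <= lo <= hi,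
    forall u, v <= u <= v' -> lo <= k u <= hi & hi - lo <= 2 * k2 * (v' - v)].
Proof.
move=> v0 vv v1; have l0 : 0 <= v' - v by rewrite subr_ge0.
have vI : 0 <= v <= 1 by rewrite v0 (le_trans vv).
have k2l : 0 <= k2 * (v' - v) by rewrite mulr_ge0// (rs_k2 gk).
have /andP[kv0 kv1] := rs_bound gk vI.
exists (Num.max k0 (k v - k2 * (v' - v))), (k v + k2 * (v' - v)); split.
- rewrite le_max lexx ge_max /= (le_trans kv0) ?lerDl//.
  by rewrite lerD2l (le_trans _ k2l)// oppr_le0.
- move=> u /andP[vu uv]; have uI : 0 <= u <= 1 by rewrite (le_trans v0)//= (le_trans uv).
  have /andP[ku0 ku1] := rs_bound gk uI.
  have : `|k u - k v| <= k2 * (v' - v).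
    apply: le_trans (rs_lip gk uI vI) _; rewrite ler_wpM2l ?(rs_k2 gk)//.
    by rewrite ger0_norm ?subr_ge0// lerD2r.
  by rewrite ler_distl ge_max ku0 => /andP[-> ->].
- rewrite lerBlDr -lerBlDl le_max; apply/orP; right.
  by rewrite le_eqVlt; apply/orP; left; apply/eqP; ring.
Qed.

(** The limiting mean length is about the speed times (g'(v') - g'(v)) / g'', and the quotient is v'
    - v up to second order. The error is quadratic in the width, so N equal cells together
    contribute O(1 / N). *)
Lemma arc_mesh (v v' : R) : 0 <= v -> v <= v' -> v' <= 1 ->
  exists lo hi : R, [/\ k0 <= lo <= hi,
    forall u, v <= u <= v' -> lo <= k u <= hi,
    0 <= (s v' - s v) / hi /\ (s v' - s v) / lo <= k1 / k0,
    speed s v' * ((s v' - s v) / lo) <=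
      arclen s v' - arclen s v + mesh_const * (v' - v) ^+ 2 &
    arclen s v' - arclen s v <=
      speed s v * ((s v' - s v) / hi) + mesh_const * (v' - v) ^+ 2].
Proof.
move=> v0 vv v1; have l0 : 0 <= v' - v by rewrite subr_ge0.
have k00 := rs_k0 gk.
have [lo [hi [/andP[k0lo lohi] kb hilo]]] := curvature_window v0 vv v1.
exists lo, hi.
have [w /kb/andP[kw0 kw1] sE] := rs_MVT gk v0 vv v1.
have /andP[growl growh] := slope_growth gk v0 vv v1.
have [||D0 Dlo Dhi] := slope_quotient (D := s v' - s v) k00 k0lo lohi hilo l0.
- by rewrite sE ler_wpM2r.
- by rewrite sE ler_wpM2r.
have DM : (s v' - s v) / lo <= k1 / k0.
  apply: (@le_trans _ _ ((s v' - s v) / k0)).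
    by rewrite ler_wpM2l ?subr_ge0 ?(slope_le gk)// lef_pV2// posrE (lt_le_trans k00).
  rewrite ler_pM2r ?invr_gt0//; apply: le_trans growh _.
  rewrite ler_piMr ?lerBlDr ?(le_trans v1) ?lerDl//.
  have vI : 0 <= v <= 1 by rewrite v0 (le_trans vv).
  have /andP[] := rs_bound gk vI; move/(le_trans (ltW k00)); exact: le_trans.
have /andP[Al Ah] := arclen_bounds gk v0 vv v1.
have S1 : speed s v' <= speed s 1.
  by apply: (speed_le gk) => //; apply: le_trans vv.
have S2 : speed s v <= speed s v' by apply: (speed_le gk).
have sD : speed s v' <= speed s v + (s v' - s v).
  by have := sqrt1_lip (s v') (s v); rewrite ger0_norm ?subr_ge0 ?(slope_le gk).
have mE : mesh_const * (v' - v) ^+ 2 = k1 * (v' - v) * (v' - v) +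
    speed s 1 * (2 * k2 * (v' - v) * (v' - v) / k0).
  by rewrite /mesh_const expr2 mulrDl; congr (_ + _); rewrite ?mulrA//; ring.
have e0 : 0 <= 2 * k2 * (v' - v) * (v' - v) / k0.
  by rewrite divr_ge0 ?(ltW k00)// !mulr_ge0// (rs_k2 gk).
rewrite mE; have [h1 h2] := mesh_arith l0 e0 (le_trans ler01 (speed_ge1 s v)) S2 S1 sD growh Al Ah Dlo Dhi.
by split => //; rewrite ?k0lo.
Qed.

(** In use, a and b are the end speeds, r1 and r2 the same with slopes divided by rho, X1 and X2 the
    normalised Bose sums with limits P and P', Y the normalised mean length, A the arc length and M
    the mesh error. The condition eta T <= om absorbs the products of errors. *)
Lemma product_arith (eta T om P P' a b r1 r2 X1 X2 Y A M : R) :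
  0 < eta -> eta <= 1 -> eta * T <= om -> 0 <= P -> 0 <= P' -> P' <= P ->
  1 <= a -> a <= b -> b + P + 1 <= T ->
  r2 <= b + eta -> a - eta <= r1 -> X1 <= P + eta -> P' - eta <= X2 ->
  0 <= r2 -> 0 <= X2 -> Y <= r2 * X1 -> r1 * X2 <= Y ->
  b * P <= A + M -> A <= a * P' + M -> - (M + om) <= Y - A <= M + om.
Proof.
move=> eta0 eta1 etaT P0 P'0 PP a1 ab bT r2b r1b X1b X2b r20 X20 Yup Ylow up low.
have h1 : r2 * X1 <= r2 * (P + eta) by rewrite ler_wpM2l.
have h2 : r2 * (P + eta) <= (b + eta) * (P + eta).
  by rewrite ler_wpM2r// addr_ge0// ltW.
have h3 : (a - eta) * X2 <= r1 * X2 by rewrite ler_wpM2r.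
have h4 : (a - eta) * (P' - eta) <= (a - eta) * X2.
  by rewrite ler_wpM2l// subr_ge0 (le_trans eta1).
have h5 : eta * (b + P + eta) <= eta * T.
  by rewrite ler_pM2l// (le_trans _ bT)// lerD2l.
have h6 : eta * (a + P') <= eta * T.
  by rewrite ler_pM2l// (le_trans _ bT)// -[leLHS]addr0 !lerD.
have h7 : 0 <= eta * eta by rewrite mulr_ge0// ltW.
by apply/andP; split; move: etaT Yup Ylow up low h1 h2 h3 h4 h5 h6 h7; clear; lra.
Qed.

(** Of the two error terms, the mesh term shrinks only with the cell, while [om] can be taken
    arbitrarily small for n large. *)
Lemma cone_mean (v v' om : R) cl : 0 <= v -> v <= v' -> v' <= 1 -> 0 < om ->
  \forall n \near n_infty (c_gamma g), exists2 Y : R,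
    (\esum_(x in prim (cone (rho g n) (s v) (s v') cl))
       (enorm R x * (zpow g n x / (1 - zpow g n x)))%:E = Y%:E)%E &
    `|n.1%:R^-1 * Y - (arclen s v' - arclen s v)| <=
      mesh_const * (v' - v) ^+ 2 + om.
Proof.
move=> v0 vv v1 om0.
have [lo [hi [/andP[k0lo lohi] kb [Dhi0 DloD] up low]]] := arc_mesh v0 vv v1.
have k00 := rs_k0 gk; have lo0 : 0 < lo by apply: lt_le_trans k0lo.
have hi0 : 0 < hi by apply: lt_le_trans lohi.
have vI : 0 <= v <= 1 by rewrite v0 (le_trans vv).
have sv0 := slope_nonneg gk vI; have svv := slope_le gk v0 vv v1.
have S1 : speed s v' <= speed s 1.
  by apply: (speed_le gk) => //; apply: le_trans vv.
have S2 : speed s v <= speed s v' by apply: (speed_le gk).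
have sv1 := speed_ge1 s v.
pose T := speed s 1 + k1 / k0 + 1.
have DD : (s v' - s v) / hi <= (s v' - s v) / lo.
  by rewrite ler_wpM2l ?subr_ge0// lef_pV2.
have T0 : 0 < T.
  rewrite ltr_wpDl// addr_ge0 ?sqrtr_ge0//.
  by apply: le_trans DloD; apply: le_trans DD.
pose eta := Num.min 1 (om / T).
have eta0 : 0 < eta by rewrite lt_min ltr01 divr_gt0.
have eta1 : eta <= 1 by rewrite ge_min lexx.
have etaT : eta * T <= om by rewrite -ler_pdivlMr// ge_min lexx orbT.
near=> n.
have [_ [n1 n2]] : (0 <= n.1%:R :> R) /\ (0 < n.1)%N /\ (0 < n.2)%N.
  by near: n; exact: n_infty_ge.
have n10 : 0 <= n.1%:R^-1 :> R by rewrite invr_ge0.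
have [W1 W1E W1b] : exists2 W, bose_sum (cone (rho g n) (s v) (s v') cl)
    (alpha g n * (kappa R * lo `^ (1 / 3))) = W%:E &
    `|n.1%:R^-1 * W - (s v' - s v) / lo| <= eta.
  by near: n; apply: bose_cone_limit.
have [W2 W2E W2b] : exists2 W, bose_sum (cone (rho g n) (s v) (s v') cl)
    (alpha g n * (kappa R * hi `^ (1 / 3))) = W%:E &
    `|n.1%:R^-1 * W - (s v' - s v) / hi| <= eta.
  by near: n; apply: bose_cone_limit.
have [r2b r1b] : `|Num.sqrt (1 + (s v' / rho g n) ^+ 2) - speed s v'| <= eta /\
    `|Num.sqrt (1 + (s v / rho g n) ^+ 2) - speed s v| <= eta.
  by near: n; exact: filterI (speed_rho_near v' eta0) (speed_rho_near v eta0).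
have [Elow Eup] := cone_sum_bounds cl n1 n2 v0 vv v1 lo0 kb.
rewrite W1E in Eup; rewrite W2E in Elow.
set r2 := Num.sqrt (1 + (s v' / rho g n) ^+ 2) in r2b Eup.
set r1 := Num.sqrt (1 + (s v / rho g n) ^+ 2) in r1b Elow.
set E := (\esum_(x in prim _) _)%E in Eup Elow *.
have Efin : E \is a fin_num.
  rewrite fin_real//; apply/andP; split.
    by apply: lt_le_trans Elow; rewrite -EFinM ltNyr.
  by apply: le_lt_trans Eup _; rewrite -EFinM ltry.
exists (fine E); first by rewrite fineK.
rewrite -(fineK Efin) -EFinM lee_fin in Eup.
rewrite -(fineK Efin) -EFinM lee_fin in Elow.
set Y := fine E in Eup Elow *.
have r10 : 0 <= r1 := sqrtr_ge0 _; have r20 : 0 <= r2 := sqrtr_ge0 _.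
have {}Eup := ler_wpM2l n10 Eup; have {}Elow := ler_wpM2l n10 Elow.
rewrite mulrCA in Eup; rewrite mulrCA in Elow.
set X1 := _ * W1 in W1b Eup; set X2 := _ * W2 in W2b Elow.
have W20 : 0 <= X2.
  rewrite mulr_ge0// -lee_fin -W2E; apply: esum_ge0 => x xS.
  have [_ al0 _] := rho_alpha n1 n2.
  rewrite lee_fin mulr_ge0// bose_weight_ge0// mulr_ge0// mulr_ge0 ?(ltW al0)//.
  by rewrite mulr_ge0 ?powR_ge0// ltW// kappa_gt0.
rewrite ler_norml in W1b; rewrite ler_norml in W2b.
rewrite ler_norml in r1b; rewrite ler_norml in r2b.
have /andP[_ {}W1b] := W1b; have /andP[{}W2b _] := W2b.
have /andP[{}r1b _] := r1b; have /andP[_ {}r2b] := r2b.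
rewrite ler_norml.
have DP : 0 <= (s v' - s v) / lo by apply: le_trans Dhi0 DD.
have Tb : speed s v' + (s v' - s v) / lo + 1 <= T.
  by rewrite /T lerD2r; exact: (lerD S1 DloD).
apply: (product_arith eta0 eta1 etaT DP Dhi0 DD sv1 S2 Tb _ _ _ _ r20 W20 Eup Elow up low).
- by move: r2b; clear; lra.
- by move: r1b; clear; lra.
- by move: W1b; clear; lra.
- by move: W2b; clear; lra.
Unshelve. all: by end_near. Qed.

(** Freezing g'' at its lower bound k0 and passing to the half scale bounds the sum by a multiple of
    W(h/2) / h, where h = alpha kappa k0^(1/3) and W is of order n_1. After division by n_1^2 this
    is at most a constant times alpha. *)
Lemma cone_variance (om : R) : 0 < om ->
  \forall n \near n_infty (c_gamma g), exists2 V : R,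
    (\esum_(x in prim (cone (rho g n) (s 0) (s 1) true))
       (enorm R x ^+ 2 * (zpow g n x / (1 - zpow g n x) ^+ 2))%:E <= V%:E)%E &
    n.1%:R^-1 ^+ 2 * V <= om.
Proof.
move=> om0; have k00 := rs_k0 gk; have kap0 := kappa_gt0 R.
have s01 := slope_le gk (lexx 0) ler01 (lexx 1).
(* S bounds the perturbed speed and D the normalised Bose sum at the half scale; halving h divides
   k0 by 8, since h contains its cube root. *)
pose S := speed s 1 + 1; pose D := (s 1 - s 0) / (k0 / 8) + 1.
have S0 : 0 < S by have := speed_ge1 s 1; rewrite /S; lra.
have D0 : 0 < D by rewrite ltr_wpDl// divr_ge0 ?subr_ge0// divr_ge0// ltW.
pose f := kappa R * k0 `^ (1 / 3); have f0 : 0 < f by rewrite mulr_gt0// powR_gt0.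
have f2 : f / 2 = kappa R * (k0 / 8) `^ (1 / 3).
  rewrite /f powRM ?invr_ge0 ?(ltW k00)//.
  have -> : (8^-1 : R) = 2^-1 `^ 3%:R.
    by rewrite powR_mulrn ?invr_ge0// exprVn; congr (_^-1); rewrite -natrX.
  rewrite -powRrM (_ : 3%:R * (1 / 3) = 1); last by field.
  by rewrite powRr1 ?invr_ge0// mulrA.
pose M := S ^+ 2 * (4 / f) * D.
have M0 : 0 < M by rewrite !mulr_gt0 ?exprn_gt0 ?invr_gt0.
near=> n.
have [_ [n1 n2]] : (0 <= n.1%:R :> R) /\ (0 < n.1)%N /\ (0 < n.2)%N.
  by near: n; exact: n_infty_ge.
have n10 : 0 <= n.1%:R^-1 :> R by rewrite invr_ge0.
have [r0 al0 a3] := rho_alpha n1 n2.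
have [W WE Wb] : exists2 W, bose_sum (cone (rho g n) (s 0) (s 1) true)
    (alpha g n * (kappa R * (k0 / 8) `^ (1 / 3))) = W%:E &
    `|n.1%:R^-1 * W - (s 1 - s 0) / (k0 / 8)| <= 1.
  by near: n; apply: bose_cone_limit => //; [exact: rs_ge0 gk|rewrite divr_gt0].
have r2b : `|Num.sqrt (1 + (s 1 / rho g n) ^+ 2) - speed s 1| <= 1.
  by near: n; exact: (speed_rho_near 1 ltr01).
have /andP[_ al1] : 0 < alpha g n < 1.
  by near: n; apply: alpha_near.
have /andP[_ alM] : 0 < alpha g n < om / M.
  by near: n; apply: alpha_near; rewrite ?divr_gt0.
have rle : rho g n <= 2.
  have : `|rho g n - 1| <= 1 by near: n; apply: rho_near.
  by rewrite ler_norml => /andP[_]; lra.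
pose h := alpha g n * f; have h0 : 0 < h by rewrite mulr_gt0.
rewrite -f2 (_ : _ * (f / 2) = h / 2) in WE; last by rewrite mulrA.
exists (S ^+ 2 * (2 / h) * W).
  rewrite EFinM -WE /bose_sum -esumZl; last 2 first.
  - by rewrite mulr_ge0 ?sqr_ge0// divr_ge0// ltW.
  - move=> x [q0 _ _]; rewrite lee_fin mulr_ge0// bose_weight_ge0//.
    by rewrite mulr_ge0// divr_ge0// ltW.
  apply: le_esum => x xS; rewrite -EFinM lee_fin; have [q0 _ _] := xS.
  have q0R : 0 < (dir1 x)%:R :> R by rewrite ltr0n.
  have xS' : cone (rho g n) (s 0) (s 1) true (val x) := xS.
  have /andP[_ eb] := enorm_cone n1 n2 (rs_ge0 gk) xS'.
  have [uI _ ->] := zpow_in n1 n2 xS.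
  have /andP[ku0 _] := rs_bound gk uI.
  set y := _ * (dir1 x)%:R.
  have hy : h * (dir1 x)%:R <= y.
    rewrite /y ler_pM2r// ler_pM2l// ler_pM2l//.
    by apply: ge0_ler_powR; rewrite ?nnegrE// ltW// (lt_le_trans k00).
  have hx0 : 0 < h * (dir1 x)%:R by rewrite mulr_gt0.
  have y0 : 0 < y by apply: lt_le_trans hy.
  have e0 : 0 <= enorm R x by rewrite sqrtr_ge0.
  have enb : enorm R x <= (dir1 x)%:R * S.
    apply: le_trans eb _; rewrite ler_pM2l//.
    by have := le_trans (ler_norm _) r2b; rewrite lerBlDr [1 + speed _ _]addrC.
  have enb2 : enorm R x ^+ 2 <= ((dir1 x)%:R * S) ^+ 2.
    by rewrite lerXn2r ?nnegrE// (le_trans e0).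
  have varb : expR (- y) / (1 - expR (- y)) ^+ 2 <=
      2 / (h * (dir1 x)%:R) * (expR (h / 2 * (dir1 x)%:R) - 1)^-1.
    apply: le_trans (geom_variance_le y0) _.
    have w1 : 2 / y <= 2 / (h * (dir1 x)%:R) by rewrite ler_pM2l// lef_pV2.
    have w2 : (expR (y / 2) - 1)^-1 <= (expR (h / 2 * (dir1 x)%:R) - 1)^-1.
      apply: bose_weight_le; first by rewrite mulr_gt0// divr_gt0.
      by rewrite mulrAC ler_pM2r.
    apply: ler_pM w1 w2; first by rewrite divr_ge0// ltW.
    by rewrite bose_weight_ge0// divr_ge0// ltW.
  have v0 : 0 <= expR (- y) / (1 - expR (- y)) ^+ 2.
    by rewrite divr_ge0 ?expR_ge0 ?sqr_ge0.
  apply: le_trans (ler_pM (sqr_ge0 _) v0 enb2 varb) _.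
  set e := (_ - 1)^-1; rewrite le_eqVlt; apply/orP; left; apply/eqP.
  by field; rewrite !lt0r_neq0.
have WD : n.1%:R^-1 * W <= D by move: Wb; rewrite ler_norml /D => /andP[_]; lra.
have -> : n.1%:R^-1 ^+ 2 * (S ^+ 2 * (2 / h) * W) =
    S ^+ 2 * (2 / h * n.1%:R^-1) * (n.1%:R^-1 * W) by ring.
(* By rho alpha^3 = 1 / n_1 the left side is (2 / f) rho alpha^2; then rho <= 2 and one factor alpha
   is at most 1. *)
have hn : 2 / h * n.1%:R^-1 <= 4 / f * alpha g n.
  have key (r a f' : R) : a != 0 -> f' != 0 ->
      2 / (a * f') * (r * a ^+ 3) = 2 / f' * (r * (a * a)).
    by move=> ? ?; field; apply/andP.
  rewrite -a3 key ?lt0r_neq0// (_ : 4 / f = 2 / f * 2); last by field; rewrite lt0r_neq0.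
  rewrite -[leRHS]mulrA ler_pM2l ?divr_gt0//.
  apply: ler_pM => //; [exact: ltW|by rewrite mulr_ge0// ltW|].
  by rewrite ler_piMr// ltW.
have hn0 : 0 <= 2 / h * n.1%:R^-1 by rewrite mulr_ge0// divr_ge0// ltW.
have W0 : 0 <= n.1%:R^-1 * W.
  rewrite mulr_ge0// -lee_fin -WE; apply: esum_ge0 => x xS.
  by rewrite lee_fin mulr_ge0// bose_weight_ge0// mulr_ge0// divr_ge0// ltW.
apply: (@le_trans _ _ (S ^+ 2 * (4 / f * alpha g n) * D)).
  apply: ler_pM WD => //; first by rewrite mulr_ge0// sqr_ge0.
  by rewrite ler_wpM2l// sqr_ge0.
move: alM; rewrite ltr_pdivlMr// /M; lra.
Unshelve. all: by end_near. Qed.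

End gamma_sums.
(** * Independent geometric variables *)

Section configurations.

Lemma measurable_coord (x : direction) (B : set nat) :
  measurable [set nu : config | B (nu x)].
Proof. by apply: sub_sigma_algebra; exists x, B. Qed.

Lemma measurable_singleton (nu : config) : measurable [set nu].
Proof.
pose F n : set config := if unpickle n is Some x then [set nu' | nu' x = nu x] else setT.
have -> : [set nu] = \bigcap_n F n.
  apply/seteqP; split => [nu' -> n _|nu' h]; first by rewrite /F; case: unpickle.
  apply/funext => x; have := h (pickle x) I; rewrite /F pickleK; exact.
apply: bigcapT_measurable => n; rewrite /F; case: unpickle => [x|//].
exact: (measurable_coord x [set nu x]).
Qed.

Lemma countable_Pi : countable Pi.
Proof.
pose supp (nu : config) := fset_set [set x | nu x != 0%N].
pose code (nu : config) : nat := pickle [seq (x, nu x) | x <- finmap.enum_fset (supp nu)].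
apply/countable_injP; exists code => nu nu'; rewrite !inE /Pi /= => fin fin'.
move=> /(pcan_inj pickleK) eqc.
have mem (mu : config) : finite_set [set x | mu x != 0%N] ->
    forall x k, ((x, k) \in [seq (y, mu y) | y <- finmap.enum_fset (supp mu)]) =
      (mu x != 0%N) && (k == mu x).
  move=> finmu x k; apply/mapP/andP => [[y yS [-> ->]]|[mx /eqP ->]].
    by split => //; move: yS; rewrite in_fset_set// inE.
  by exists x => //; rewrite in_fset_set// inE.
apply/funext => x; have [nx|nx] := eqVneq (nu x) 0%N.
  apply/eqP; apply: contraT => nn.
  have : (x, nu' x) \in [seq (y, nu y) | y <- finmap.enum_fset (supp nu)].
    by rewrite eqc mem// eqxx andbT -nx eq_sym.
  by rewrite mem// nx eqxx.
have : (x, nu x) \in [seq (y, nu' y) | y <- finmap.enum_fset (supp nu')].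
  by rewrite -eqc mem// nx eqxx.
by rewrite mem// => /andP[_ /eqP].
Qed.

(** Every event inside the countable set [Pi] is measurable, so the supremum over uncountably many t
    in [dL] calls for no separate argument. *)
Lemma measurable_sub_Pi (A : set config) : A `<=` Pi -> measurable A.
Proof.
move=> AP; apply: countable_measurable; first exact: measurable_singleton.
exact: sub_countable (subset_card_le AP) countable_Pi.
Qed.

End configurations.

Section geometric_family.
Variables (R : realType) (Q : probability config R) (z : direction -> R).
Hypothesis z01 : forall x, 0 <= z x < 1.
Hypothesis indep :
  mutually_independent Q (fun (x : direction) (nu : config) => nu x).
Hypothesis law : forall x k,
  Q [set nu | nu x = k] = (z x ^+ k * (1 - z x))%:E.

Lemma measurable_fun_coord (A : set config) (x : direction) (f : nat -> R) :
  measurable A -> measurable_fun A (fun nu : config => f (nu x)).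
Proof.
by move=> mA _ Y mY; apply: measurableI => //; exact: (measurable_coord x (f @^-1` Y)).
Qed.

Lemma integral_coord_split (A : set config) (x : direction) (h : config -> R) :
  measurable A -> measurable_fun A h -> (forall nu, 0 <= h nu) ->
  (\int[Q]_(nu in A) (h nu)%:E =
   \esum_(k in [set: nat]) \int[Q]_(nu in A `&` [set nu | nu x = k]) (h nu)%:E)%E.
Proof.
move=> mA mh h0.
have AE : A = \bigcup_k (A `&` [set nu | nu x = k]).
  by apply/seteqP; split => [nu Anu|nu [k _ []]//]; exists (nu x).
rewrite {1}AE ge0_integral_bigcup.
- rewrite nneseries_esumT// => k.
  by apply: integral_ge0 => nu _; rewrite lee_fin.
- by move=> k; apply: measurableI => //; exact: (measurable_coord x [set k]).
- by rewrite -AE; apply/measurable_EFinP.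
- by move=> nu _; rewrite lee_fin.
- by move=> i j _ _ [nu [[_ /= <-] [_ /= <-]]].
Qed.

Lemma integral_coord (A : set config) (x : direction) (f : nat -> R) :
  measurable A -> (forall k, 0 <= f k) ->
  (\int[Q]_(nu in A) (f (nu x))%:E =
   \esum_(k in [set: nat]) ((f k)%:E * Q (A `&` [set nu | nu x = k])))%E.
Proof.
move=> mA f0; rewrite (@integral_coord_split _ x)//; last exact: measurable_fun_coord.
apply: eq_esum => k _.
have mAk : measurable (A `&` [set nu : config | nu x = k]).
  by apply: measurableI => //; exact: (measurable_coord x [set k]).
by rewrite -integral_cst//; apply: eq_integral => nu; rewrite inE => -[_ /= ->].
Qed.

Lemma expectation_coord (x : direction) (f : nat -> R) : (forall k, 0 <= f k) ->
  (\int[Q]_nu (f (nu x))%:E =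
   \esum_(k in [set: nat]) (f k * (z x ^+ k * (1 - z x)))%:E)%E.
Proof.
move=> f0; rewrite integral_coord//; apply: eq_esum => k _.
by rewrite setTI law -EFinM.
Qed.

Lemma law_pair (x y : direction) k l : x != y ->
  Q ([set nu | nu x = k] `&` [set nu | nu y = l]) =
  (Q [set nu | nu x = k] * Q [set nu | nu y = l])%E.
Proof.
move=> xy; pose B i : set nat := if i == x then [set k] else [set l].
have := indep (s := [:: x; y]) (B := B).
rewrite /= inE xy => /(_ isT) /(_ (fun _ _ => I)).
rewrite 2!big_cons big_nil mule1 /B eqxx [y == x]eq_sym (negbTE xy) => <-.
congr (Q _); apply/seteqP; split => [nu [/= nx ny] i|nu h].
  rewrite /= !inE => /orP[] /eqP ->; rewrite ?eqxx//=.
  by rewrite eq_sym (negbTE xy).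
split; first by have := h x; rewrite /= !inE eqxx; apply.
by have := h y; rewrite /= !inE eqxx orbT eq_sym (negbTE xy); apply.
Qed.

(** Splitting on the values of nu x and then of nu y reduces the product rule to the joint law of a
    pair. *)
Lemma expectation_pair (x y : direction) (f h : nat -> R) (Eh : R) : x != y ->
  (forall k, 0 <= f k) -> (forall k, 0 <= h k) ->
  (\int[Q]_nu (h (nu y))%:E = Eh%:E)%E ->
  (\int[Q]_nu (f (nu x) * h (nu y))%:E = Eh%:E * \int[Q]_nu (f (nu x))%:E)%E.
Proof.
move=> xy f0 h0 EhE.
have Eh0 : 0 <= Eh by rewrite -lee_fin -EhE integral_ge0// => nu _; rewrite lee_fin.
have w0 y' k : 0 <= z y' ^+ k * (1 - z y').
  have /andP[z0 /ltW z1] := z01 y'.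
  by rewrite mulr_ge0 ?exprn_ge0 ?subr_ge0.
rewrite [LHS](@integral_coord_split _ x)//; last 2 first.
- by apply: measurable_funM; exact: measurable_fun_coord.
- by move=> nu; rewrite mulr_ge0.
rewrite expectation_coord// -esumZl//; last first.
  by move=> k _; rewrite lee_fin mulr_ge0.
apply: eq_esum => k _; rewrite setTI.
have mk : measurable [set nu : config | nu x = k] by exact: (measurable_coord x [set k]).
transitivity (\int[Q]_(nu in [set nu | nu x = k]) ((f k)%:E * (h (nu y))%:E))%E.
  by apply: eq_integral => nu; rewrite inE => /= ->.
rewrite ge0_integralZl_EFin//; last 2 first.
- by move=> nu _; rewrite lee_fin.
- by apply/measurable_EFinP; exact: measurable_fun_coord.
rewrite EFinM muleCA; congr (_ * _)%E; rewrite -EhE expectation_coord// integral_coord//.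
rewrite muleC -esumZl//; last by move=> l _; rewrite lee_fin mulr_ge0.
apply: eq_esum => l _; rewrite law_pair// !law -!EFinM; congr EFin; ring.
Qed.

(** Mean and variance of the geometric law with parameter z x. *)
Let m x : R := z x / (1 - z x).
Let var x : R := z x / (1 - z x) ^+ 2.

Lemma expectation_nat x : (\int[Q]_nu ((nu x)%:R)%:E = (m x)%:E)%E.
Proof.
have /andP[z0 z1] := z01 x; have z1' : 0 < 1 - z x by rewrite subr_gt0.
rewrite (@expectation_coord x (fun k => k%:R))//.
under eq_esum do rewrite mulrA mulrC EFinM.
rewrite esumZl ?(ltW z1')//; last first.
  by move=> k _; rewrite lee_fin mulr_ge0 ?exprn_ge0.
rewrite esum_geom1 ?z01// -EFinM; congr EFin; rewrite /m.
by field; rewrite gt_eqF.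
Qed.

Lemma expectation_nat2 x :
  (\int[Q]_nu ((nu x)%:R ^+ 2)%:E = (m x ^+ 2 + var x)%:E)%E.
Proof.
have /andP[z0 z1] := z01 x; have z1' : 0 < 1 - z x by rewrite subr_gt0.
rewrite (@expectation_coord x (fun k => k%:R ^+ 2))//.
under eq_esum do rewrite mulrA mulrC EFinM.
rewrite esumZl ?(ltW z1')//; last first.
  by move=> k _; rewrite lee_fin mulr_ge0 ?exprn_ge0 ?sqr_ge0.
rewrite esum_geom2 ?z01// -EFinM; congr EFin; rewrite /m /var.
by field; rewrite gt_eqF.
Qed.

(** * Second moments and Chebyshev's inequality for finite weighted sums *)

Section chebyshev.
Variables (F : seq direction) (c : direction -> R).
Hypothesis uF : uniq F.
Hypothesis c0 : forall x, 0 <= c x.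

Let S (nu : config) : R := \sum_(x <- F) c x * (nu x)%:R.
Let mu : R := \sum_(x <- F) c x * m x.
Let V : R := \sum_(x <- F) c x ^+ 2 * var x.

Let S_ge0 nu : 0 <= S nu.
Proof. by apply: sumr_ge0 => x _; rewrite mulr_ge0. Qed.

Let m_ge0 x : 0 <= m x.
Proof. by have /andP[z0 /ltW z1] := z01 x; rewrite divr_ge0// subr_ge0. Qed.

Let mu_ge0 : 0 <= mu.
Proof. by apply: sumr_ge0 => x _; rewrite mulr_ge0. Qed.

Let measurable_S : measurable_fun setT S.
Proof.
apply: measurable_sum => x; exact: (measurable_fun_coord x (fun k => c x * k%:R)).
Qed.

Lemma expectation_sum : (\int[Q]_nu (S nu)%:E = mu%:E)%E.
Proof.
under eq_integral do rewrite /S -sumEFin.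
rewrite ge0_integral_sum//; last 2 first.
- move=> x; apply/measurable_EFinP.
  exact: (measurable_fun_coord x (fun k => c x * k%:R)).
- by move=> x nu _; rewrite lee_fin mulr_ge0.
rewrite /mu -sumEFin; apply: eq_bigr => x _.
under eq_integral do rewrite EFinM.
rewrite ge0_integralZl_EFin//; first by rewrite expectation_nat.
apply/measurable_EFinP; exact: (measurable_fun_coord x (fun k => k%:R)).
Qed.

Lemma expectation_sum2 : (\int[Q]_nu (S nu ^+ 2)%:E = (mu ^+ 2 + V)%:E)%E.
Proof.
have SE nu : (S nu ^+ 2)%:E =
    (\sum_(x <- F) \sum_(y <- F) (c x * c y * ((nu x)%:R * (nu y)%:R))%:E)%E.
  rewrite expr2 /S mulr_suml -sumEFin; apply: eq_bigr => x _.
  by rewrite mulr_sumr -sumEFin; apply: eq_bigr => y _; congr EFin; ring.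
have mxy x y : measurable_fun setT
    (EFin \o (fun nu : config => c x * c y * ((nu x)%:R * (nu y)%:R))).
  apply/measurable_EFinP; apply: measurable_funM => //; apply: measurable_funM.
    exact: (measurable_fun_coord x (fun k => k%:R)).
  exact: (measurable_fun_coord y (fun k => k%:R)).
have pos x y nu : (0 <= (c x * c y * ((nu x)%:R * (nu y)%:R))%:E)%E.
  by rewrite lee_fin !mulr_ge0.
under eq_integral do rewrite SE.
rewrite ge0_integral_sum//; last 2 first.
- by move=> x; apply: emeasurable_sum => y; exact: mxy.
- by move=> x nu _; apply: sume_ge0 => y _.
have inner x y : (\int[Q]_nu (c x * c y * ((nu x)%:R * (nu y)%:R))%:E =
    (c x * m x * (c y * m y) + (x == y)%:R * (c x ^+ 2 * var x))%:E)%E.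
  under eq_integral do rewrite EFinM.
  have pnn (nu : config) : setT nu -> (0 <= ((nu x)%:R * (nu y)%:R : R)%:E)%E.
    by rewrite lee_fin mulr_ge0.
  have mm : measurable_fun setT (EFin \o (fun nu : config => (nu x)%:R * (nu y)%:R : R)).
    apply/measurable_EFinP; apply: measurable_funM.
      exact: (measurable_fun_coord x (fun k => k%:R)).
    exact: (measurable_fun_coord y (fun k => k%:R)).
  rewrite (ge0_integralZl_EFin Q measurableT pnn mm) ?mulr_ge0//.
  have [<-|xy] := eqVneq x y.
    under eq_integral do rewrite -expr2.
    by rewrite expectation_nat2 -EFinM -[true%:R]/(1 : R); congr EFin; ring.
  rewrite (expectation_pair (f := fun k => k%:R) (h := fun k => k%:R) (Eh := m y))//.
    by rewrite expectation_nat -!EFinM -[false%:R]/(0 : R); congr EFin; ring.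
  exact: expectation_nat.
transitivity (\sum_(x <- F) (c x * m x * mu + c x ^+ 2 * var x)%:E)%E.
  rewrite big_seq [RHS]big_seq; apply: eq_bigr => x xF.
  rewrite (ge0_integral_sum Q measurableT (mxy x) (fun y nu _ => pos x y nu)).
  under eq_bigr do rewrite inner.
  rewrite sumEFin; congr EFin; rewrite big_split/= -mulr_sumr; congr (_ + _).
  rewrite (bigD1_seq x)//= eqxx mul1r big1 ?addr0// => y yx.
  by rewrite eq_sym (negbTE yx) mul0r.
by rewrite sumEFin big_split/= -mulr_suml expr2.
Qed.

(** The identity (S - mu)^2 + 2 mu S = S^2 + mu^2 has nonnegative terms on both sides, so it can be
    integrated without integrability conditions. *)
Lemma expectation_deviation : (\int[Q]_nu ((S nu - mu) ^+ 2)%:E = V%:E)%E.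
Proof.
have mS := measurable_S.
have md : measurable_fun setT (fun nu : config => (S nu - mu) ^+ 2).
  by apply: measurable_funX; exact: measurable_funB.
have : (\int[Q]_nu (((S nu - mu) ^+ 2)%:E + (2 * mu)%:E * (S nu)%:E) =
        \int[Q]_nu ((S nu ^+ 2)%:E + (mu ^+ 2)%:E))%E.
  by apply: eq_integral => nu _; rewrite -EFinM -!EFinD; congr EFin; ring.
rewrite !ge0_integralD//; last 7 first.
- by move=> nu _; rewrite lee_fin sqr_ge0.
- by apply/measurable_EFinP; exact: measurable_funX.
- by move=> nu _; rewrite lee_fin sqr_ge0.
- by move=> nu _; rewrite lee_fin sqr_ge0.
- exact/measurable_EFinP.
- by move=> nu _; rewrite -EFinM lee_fin !mulr_ge0.
- by apply/measurable_EFinP; exact: measurable_funM.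
rewrite ge0_integralZl_EFin//; last 3 first.
- by move=> nu _; rewrite lee_fin.
- exact/measurable_EFinP.
- by rewrite mulr_ge0.
have cE : (\int[Q]__ (mu ^+ 2)%:E = (mu ^+ 2)%:E)%E.
  by rewrite -[RHS]mule1 -(probability_setT Q); exact: integral_cst.
rewrite expectation_sum expectation_sum2 cE.
rewrite -EFinM -EFinD.
case: (\int[Q]_nu _)%E => // r [re]; congr EFin; lra.
Qed.

Lemma chebyshev_sum (eta : R) : 0 < eta ->
  (Q [set nu | (eta <= `|S nu - mu|)%R] <= (V / eta ^+ 2)%:E)%E.
Proof.
move=> eta0; set E := [set nu | _].
have mS := measurable_S.
have md : measurable_fun setT (EFin \o (fun nu : config => (S nu - mu) ^+ 2)).
  by apply/measurable_EFinP; apply: measurable_funX; exact: measurable_funB.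
have mE : measurable E.
  have mn : measurable_fun setT (fun nu : config => `|S nu - mu|).
    by apply: measurableT_comp => //; exact: measurable_funB.
  have := mn measurableT `[eta, +oo[%classic (measurable_itv _).
  rewrite setTI; congr measurable; apply/seteqP.
  by split => nu; rewrite /E /= in_itv/= andbT.
have e20 : 0 < eta ^+ 2 by rewrite exprn_gt0.
rewrite EFinM muleC lee_pdivlMl//.
rewrite -expectation_deviation -integral_cst//.
apply: (@le_trans _ _ (\int[Q]_(nu in E) ((S nu - mu) ^+ 2)%:E)%E).
  apply: ge0_le_integral => //.
  - by move=> nu _; rewrite lee_fin sqr_ge0.
  - exact: measurable_funS md.
  - move=> nu; rewrite /E /= lee_fin => h.
    by rewrite -[leRHS]real_normK ?num_real// lerXn2r ?nnegrE// ltW.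
by apply: ge0_subset_integral => // nu _; rewrite lee_fin sqr_ge0.
Qed.

End chebyshev.

(** Union bound over the countably many directions outside F, with Q(nu(x) <> 0) = z x. *)
Lemma off_support (F : set direction) :
  measurable [set nu : config | exists x, ~ F x /\ nu x <> 0%N] /\
  (Q [set nu | exists x, ~ F x /\ nu x <> 0%N] <=
   \esum_(x in ~` F) (z x)%:E)%E.
Proof.
pose B n : set config :=
  if pickle_inv n is Some x then [set nu | ~ F x /\ nu x <> 0%N] else set0.
have BE : [set nu : config | exists x, ~ F x /\ nu x <> 0%N] = \bigcup_n B n.
  apply/seteqP; split => [nu [x h]|nu [n _]].
    by exists (pickle x) => //; rewrite /B pickleK_inv.
  by rewrite /B; case: pickle_inv => // x h; exists x.
have mB n : measurable (B n).
  rewrite /B; case: pickle_inv => [x|//].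
  exact: (measurable_coord x [set k | ~ F x /\ k <> 0%N]).
have mU : measurable (\bigcup_n B n) by exact: bigcupT_measurable.
rewrite BE; split => //.
apply: (@le_trans _ _ (\sum_(n <oo) Q (B n))%E).
  exact: measure_sigma_subadditive.
rewrite nneseries_esumT//.
have -> : (\esum_(n in [set: nat]) Q (B n) =
    \esum_(n in pickle @` ~` F) Q (B n))%E.
  rewrite [RHS]esum_mkcond; apply: eq_esum => n _; case: ifPn => // /negP nF.
  rewrite /B; case e : (pickle_inv n) => [x|]; last by rewrite measure0.
  rewrite (_ : [set nu | _] = set0) ?measure0//; apply/seteqP; split => // nu [Fx _].
  apply: nF; rewrite inE; exists x => //.
  by have := @pickle_invK direction n; rewrite e.
rewrite esum_image; last by move=> x y _ _; exact: (pcan_inj pickleK).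
apply: le_esum => x Fx; rewrite /B pickleK_inv.
rewrite (_ : [set nu | _] = ~` [set nu : config | nu x = 0%N]); last first.
  by apply/seteqP; split => [nu []|nu h]; [|split].
rewrite probability_setC; last exact: (measurable_coord x [set 0%N]).
by rewrite law expr0 mul1r -EFinB opprB addrC subrK.
Qed.

End geometric_family.
(** * Subdivision of the curve *)

Section pieces.
Variables (R : realType) (g : R -> R) (k0 k1 k2 : R).
Hypothesis gk : regular_slope (derI g) (derI (derI g)) k0 k1 k2.
Hypothesis c0 : 0 < c_gamma g.
Variable M : nat.
Local Notation N := M.+1.
Local Notation s := (derI g).
Implicit Types (n : nat * nat) (x : direction) (i j : nat).

Definition node (j : nat) : R := j%:R / N%:R.

Lemma node0 : node 0 = 0. Proof. by rewrite /node mul0r. Qed.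

Lemma nodeN : node N = 1. Proof. by rewrite /node divff// pnatr_eq0. Qed.

Lemma node_ge0 j : 0 <= node j. Proof. by rewrite /node divr_ge0. Qed.

Lemma node_le i j : (node i <= node j) = (i <= j)%N.
Proof. by rewrite /node ler_pM2r ?invr_gt0 ?ltr0n// ler_nat. Qed.

Lemma node_le1 j : (j <= N)%N -> node j <= 1.
Proof. by rewrite -nodeN node_le. Qed.

Lemma nodeS j : node j.+1 - node j = N%:R^-1.
Proof. by rewrite /node -mulrBl -natr1 addrAC subrr add0r mul1r. Qed.

Lemma nodeSS j : node j.+2 - node j = 2 / N%:R.
Proof. by rewrite /node -mulrBl -addn2 natrD addrAC subrr add0r. Qed.

Lemma node_itv j : (j <= N)%N -> 0 <= node j <= 1.
Proof. by move=> jN; rewrite node_ge0 node_le1. Qed.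

Definition full n : set (nat * nat) := cone (rho g n) (s 0) (s 1) true.

(** Only the last piece is closed on the right, so that the pieces partition [full n]. *)
Definition piece n j : set (nat * nat) :=
  cone (rho g n) (s (node j)) (s (node j.+1)) (j.+1 == N).

Lemma piece_full n j y : (j < N)%N -> piece n j y -> full n y.
Proof.
by move=> jN; apply: (cone_sub gk); rewrite ?node_ge0 ?node_le ?node_le1.
Qed.

Lemma piece_lower n j y : piece n j y ->
  (0 < y.1)%N /\ s (node j) * y.1%:R <= rho g n * y.2%:R.
Proof. by case. Qed.

Lemma piece_upper n j y : piece n j y -> rho g n * y.2%:R <= s (node j.+1) * y.1%:R.
Proof. by case=> _ _; case: ifP => // _ /ltW. Qed.

(** The index is the largest one whose lower slope condition holds. *)
Lemma piece_unique n y : full n y ->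
  exists j : 'I_N, forall i : 'I_N, `[< piece n i y >] = (i == j).
Proof.
move=> [q0 lo hi]; have q0R : 0 < y.1%:R :> R by rewrite ltr0n.
pose P (i : 'I_N) := s (node i) * y.1%:R <= rho g n * y.2%:R.
have P0 : P ord0 by rewrite /P node0.
case: (@arg_maxnP 'I_N ord0 P (fun i : 'I_N => i : nat) P0) => j Pj jmax.
exists j => i; apply/idP/eqP => [/asboolP pi|->].
  apply/val_inj/eqP; rewrite eqn_leq; have [_ li] := piece_lower pi.
  rewrite [X in X && _](jmax i li) /= leqNgt; apply/negP => ij.
  have iN : (i.+1 < N)%N by apply: leq_ltn_trans ij (ltn_ord j).
  have [_ _] := pi; rewrite ltn_eqF// ltNge => /negP; apply.
  apply: le_trans Pj; rewrite ler_pM2r//.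
  apply: (slope_le gk); [exact: node_ge0|by rewrite node_le|].
  exact: node_le1 (ltnW (ltn_ord j)).
apply/asboolP; split => //; case: ifPn => [/eqP ->|jN]; first by rewrite nodeN.
have jN' : (j.+1 < N)%N by rewrite ltn_neqAle jN ltn_ord.
rewrite ltNge; apply/negP => h.
by have := jmax (Ordinal jN') h; rewrite /= ltnn.
Qed.

Lemma sum_pieces n (F : seq direction) (f : direction -> R) :
  (forall x, x \in F -> full n (val x)) ->
  \sum_(x <- F) f x = \sum_(j < N) \sum_(x <- F) `[< piece n j (val x) >]%:R * f x.
Proof.
move=> Ff; rewrite exchange_big/= big_seq [RHS]big_seq; apply: eq_bigr => x xF.
have [j jE] := piece_unique (Ff x xF).
rewrite (bigD1 j)//= jE eqxx mul1r big1 ?addr0// => i ij.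
by rewrite jE (negbTE ij) mul0r.
Qed.

Lemma arclen0 : arclen s 0 = 0.
Proof. by rewrite /arclen set_itv1 Rintegral_set1. Qed.

Lemma arclen_lip (u v : R) : 0 <= u -> u <= v -> v <= 1 ->
  0 <= arclen s v - arclen s u <= speed s 1 * (v - u).
Proof.
move=> u0 uv v1; have /andP[h1 h2] := arclen_bounds gk u0 uv v1.
have h0 : 0 <= speed s u * (v - u).
  by apply: mulr_ge0; [exact: sqrtr_ge0|rewrite subr_ge0].
rewrite (le_trans h0 h1) /=.
apply: le_trans h2 _; rewrite ler_wpM2r ?subr_ge0//.
by apply: (speed_le gk) => //; apply: le_trans uv.
Qed.

Lemma sum_arclen a : \sum_(j < a) (arclen s (node j.+1) - arclen s (node j)) =
  arclen s (node a).
Proof.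
rewrite -(big_mkord xpredT (fun j => arclen s (node j.+1) - arclen s (node j))).
by rewrite telescope_sumr// node0 arclen0 subr0.
Qed.

(* Truncating the line at slope t selects whole pieces, except possibly the
   piece containing the point of the curve with slope t and its neighbours. *)
Section selection.
Variables (n : nat * nat) (t : \bar R).
Hypothesis n1 : (0 < n.1)%N.
Hypothesis n2 : (0 < n.2)%N.
(** Consecutive nodes differ in slope by at least k0 / N, so multiplication by rho moves the slope
    at a node by less than one such gap. *)
Hypothesis rho1 : `|rho g n - 1| * s 1 < k0 / N%:R.
Hypothesis t0 : (0 <= t)%E.
Let w := u_gamma g t.
(** Index of the cell containing w; it equals N when w = 1, and then the next node lies beyond 1. *)
Let i0 := Num.truncn (N%:R * w).

Lemma u_gamma_itv : 0 <= w <= 1.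
Proof. by have [] := u_gammaP gk t0. Qed.

Lemma node_floor_itv : node i0 <= w < node i0.+1.
Proof.
have /andP[w0 w1] := u_gamma_itv; have N0 : 0 < N%:R :> R by rewrite ltr0n.
have /truncn_itv/andP[h1 h2] : 0 <= N%:R * w by rewrite mulr_ge0.
by rewrite /node ler_pdivrMr// ltr_pdivlMr// ![w * _]mulrC h1 h2.
Qed.

Lemma node_floor_le : (i0 <= N)%N.
Proof.
have /andP[h _] := node_floor_itv; have /andP[_ w1] := u_gamma_itv.
by rewrite -node_le nodeN (le_trans h).
Qed.

Lemma slope_gap i j : (i < j <= N)%N -> s (node i) + k0 / N%:R <= s (node j).
Proof.
move=> /andP[ij jN]; have nn : node i <= node j by rewrite node_le ltnW.
have /andP[h _] := slope_growth gk (node_ge0 i) nn (node_le1 jN).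
rewrite addrC -lerBrDr; apply: le_trans h; rewrite ler_pM2l ?(rs_k0 gk)//.
by rewrite -(nodeS i) lerD2r node_le.
Qed.

Lemma rho_slope j : (j <= N)%N -> `|rho g n * s (node j) - s (node j)| < k0 / N%:R.
Proof.
move=> jN; apply: le_lt_trans rho1.
rewrite -[X in _ - X]mul1r -mulrBl normrM ler_wpM2l//.
have jI := node_itv jN; rewrite ger0_norm ?(slope_nonneg gk)//.
by apply: (slope_le gk); rewrite ?node_ge0 ?node_le1.
Qed.

Lemma tau_fin x : (0 < dir1 x)%N -> tau R x = ((dir2 x)%:R / (dir1 x)%:R)%:E.
Proof. by move=> q0; rewrite /tau /slope pnatr_eq0 gtn_eqF. Qed.

(** A margin of one cell absorbs rho: rho tau(x) <= s (node (j+1)) <= s (node i0) - k0 / N <= rho s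
    (node i0), whence tau(x) <= s (node i0) <= s w <= t. *)
Lemma piece_below x j : (j.+2 <= i0)%N -> piece n j (val x) -> (tau R x <= t)%E.
Proof.
move=> ji px; have [q0 _] := piece_lower px; have up := piece_upper px.
have q0R : 0 < (dir1 x)%:R :> R by rewrite ltr0n.
have [r0 _ _] := rho_alpha c0 n1 n2.
have [_ /(_ _)/wrap[|wt _]] := u_gammaP gk t0.
  have /andP[h _] := node_floor_itv; apply: lt_le_trans h.
  by rewrite /node divr_gt0// ltr0n (leq_trans _ ji).
apply: le_trans wt; rewrite tau_fin// lee_fin ler_pdivrMr//.
have /andP[h _] := node_floor_itv; have /andP[_ w1] := u_gamma_itv.
apply: (@le_trans _ _ (s (node i0) * (dir1 x)%:R)); last first.
  by rewrite ler_pM2r// (slope_le gk)// node_ge0.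
rewrite -(ler_pM2l r0); apply: le_trans up _; rewrite mulrA ler_pM2r//.
have := rho_slope node_floor_le; rewrite ltr_norml => /andP[h1 _].
have h2 := @slope_gap j.+1 i0; rewrite ji node_floor_le in h2.
have {}h2 := h2 isT; rewrite ltrBrDr addrC in h1.
by rewrite -lerBrDr in h2; apply: le_trans h2 (ltW h1).
Qed.

Lemma piece_above x j : (i0.+2 <= j < N)%N -> piece n j (val x) ->
  (tau R x <= t)%E = false.
Proof.
move=> /andP[ij jN] px; have [q0 lo] := piece_lower px.
have q0R : 0 < (dir1 x)%:R :> R by rewrite ltr0n.
have [r0 _ _] := rho_alpha c0 n1 n2.
have iN : (i0.+1 <= N)%N by apply: leq_trans (ltnW ij) (ltnW jN).
have /andP[_ h] := node_floor_itv; have /andP[w0 _] := u_gamma_itv.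
have [_ _ /(_ _)/wrap[|tw]] := u_gammaP gk t0.
  by apply: lt_le_trans h (node_le1 iN).
apply/negbTE; rewrite -ltNge; apply: le_lt_trans tw _.
rewrite tau_fin// lte_fin ltr_pdivlMr//.
apply: (@le_lt_trans _ _ (s (node i0.+1) * (dir1 x)%:R)).
  by rewrite ler_pM2r//; apply: (slope_le gk); rewrite ?(ltW h) ?node_le1.
rewrite -(ltr_pM2l r0); apply: lt_le_trans lo; rewrite mulrA ltr_pM2r//.
have := rho_slope iN; rewrite ltr_norml => /andP[_ h1].
have h2 := @slope_gap i0.+1 j; rewrite ij (ltnW jN) in h2.
have {}h2 := h2 isT; rewrite ltrBlDr addrC in h1.
exact: lt_le_trans h1 h2.
Qed.

(** Pieces of index below i0 - 1 are selected entirely, those from i0 + 2 on not at all, and the at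
    most three in between contribute between 0 and their full sum. Up to eta per piece, the selected
    length thus lies between the arc lengths at two nodes within 2 / N of w. *)
Lemma select_bound (F : seq direction) (f : direction -> R) (eta : R) :
  (forall x, x \in F -> full n (val x)) -> (forall x, 0 <= f x) -> 0 <= eta ->
  (forall j, (j < N)%N ->
    `|\sum_(x <- F) `[< piece n j (val x) >]%:R * f x -
      (arclen s (node j.+1) - arclen s (node j))| <= eta) ->
  `|\sum_(x <- F | (tau R x <= t)%E) f x - arclen s w| <=
    2 * speed s 1 / N%:R + N%:R * eta.
Proof.
move=> Ff f0 eta0 Yb.
pose Y j := \sum_(x <- F) `[< piece n j (val x) >]%:R * f x.
pose L j := arclen s (node j.+1) - arclen s (node j).
pose Z j := \sum_(x <- F) `[< piece n j (val x) >]%:R * (if (tau R x <= t)%E then f x else 0).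
have XE : \sum_(x <- F | (tau R x <= t)%E) f x = \sum_(j < N) Z j.
  by rewrite big_mkcond/= (sum_pieces _ Ff).
have Z0 j : 0 <= Z j.
  by apply: sumr_ge0 => x _; rewrite mulr_ge0//; case: ifP.
have ZY j : Z j <= Y j.
  by apply: ler_sum => x _; rewrite ler_wpM2l//; case: ifP.
have Zlow j : (j.+2 <= i0)%N -> Z j = Y j.
  move=> ji; apply: eq_bigr => x _; case: asboolP => [px|_]; last by rewrite !mul0r.
  by rewrite (piece_below ji px).
have Zup j : (i0.+2 <= j < N)%N -> Z j = 0.
  move=> ji; apply: big1 => x _; case: asboolP => [px|_]; last by rewrite mul0r.
  by rewrite (piece_above ji px) mulr0.
have /andP[w0 w1] := u_gamma_itv; have /andP[iw wi] := node_floor_itv.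
have cstE : \sum_(j < N) eta = N%:R * eta by rewrite sumr_const card_ord mulr_natl.
have NV : 0 <= N%:R^-1 :> R by rewrite invr_ge0.
have sp1 : 0 <= speed s 1 by rewrite sqrtr_ge0.
have bnd a : (a <= N)%N -> `|\sum_(j < N | (j < a)%N) (Y j - L j)| <= N%:R * eta.
  move=> aN; apply: le_trans (ler_norm_sum _ _ _) _; rewrite -cstE big_mkcond/=.
  by apply: ler_sum => j _; case: ifP => // _; exact: Yb.
have sumL a : (a <= N)%N -> \sum_(j < N | (j < a)%N) L j = arclen s (node a).
  by move=> aN; rewrite -(big_ord_widen N L aN) sum_arclen.
have up : \sum_(j < N) Z j <= arclen s w + 2 * speed s 1 / N%:R + N%:R * eta.
  pose a := minn i0.+2 N; have aN : (a <= N)%N by rewrite geq_minr.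
  have h1 : \sum_(j < N) Z j <= \sum_(j < N | (j < a)%N) Y j.
    rewrite [leRHS]big_mkcond/=; apply: ler_sum => j _; case: ifPn => // ja.
    rewrite Zup// ltn_ord andbT leqNgt; apply: contra ja => ji.
    by rewrite /a leq_min ji ltn_ord.
  have wa : w <= node a.
    rewrite /a; case: (leqP i0.+2 N) => _; last by rewrite nodeN.
    by rewrite (le_trans (ltW wi))// node_le.
  have aw : node a - w <= 2 / N%:R.
    apply: (@le_trans _ _ (node i0.+2 - node i0)).
      by apply: lerB => //; rewrite node_le geq_minl.
    by rewrite nodeSS.
  have /andP[_ h2] := arclen_lip w0 wa (node_le1 aN).
  have h3 : speed s 1 * (node a - w) <= 2 * speed s 1 / N%:R.
    by rewrite -mulrA mulrCA ler_wpM2l.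
  have := bnd a aN; rewrite sumrB sumL// => /(le_trans (ler_norm _)).
  rewrite lerBlDl => h4; apply: le_trans h1 (le_trans h4 _).
  by rewrite lerD2r -lerBlDl; exact: le_trans h2 h3.
have low : arclen s w - 2 * speed s 1 / N%:R - N%:R * eta <= \sum_(j < N) Z j.
  (* For i0 = 0 the predecessor is 0 again, and the lower sum is empty. *)
  pose a := i0.-1; have aN : (a <= N)%N by apply: leq_trans (leq_pred _) node_floor_le.
  have h1 : \sum_(j < N | (j < a)%N) Y j <= \sum_(j < N) Z j.
    rewrite big_mkcond/=; apply: ler_sum => j _; case: ifPn => // ja.
    by rewrite Zlow// -ltn_predRL.
  have wa : node a <= w by rewrite (le_trans _ iw)// node_le leq_pred.
  have aw : w - node a <= 2 / N%:R.
    apply: (@le_trans _ _ (node a.+2 - node a)).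
      by rewrite lerD2r (le_trans (ltW wi))// node_le ltnS leqSpred.
    by rewrite nodeSS.
  have /andP[_ h2] := arclen_lip (node_ge0 a) wa w1.
  have h3 : speed s 1 * (w - node a) <= 2 * speed s 1 / N%:R.
    by rewrite -mulrA mulrCA ler_wpM2l.
  have := bnd a aN; rewrite sumrB sumL// ler_norml => /andP[h4 _].
  rewrite lerBrDr in h4; apply: le_trans (le_trans h4 h1).
  by rewrite [leRHS]addrC lerD2r lerBlDr -lerBlDl; exact: le_trans h2 h3.
by rewrite XE ler_distl opprD !addrA low.
Qed.

End selection.

End pieces.
(** * Convergence *)

Section truncation.
Variables (R : realType) (T : choiceType).
Implicit Types (w : T -> R) (D S : set T) (F : seq T).

Lemma esum_seq_setI w S F : uniq F -> (forall x, 0 <= w x) ->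
  (\esum_(x in S `&` [set` F]) (w x)%:E =
   (\sum_(x <- F) `[< S x >]%:R * w x)%:E)%E.
Proof.
move=> uF w0; rewrite esum_mkcondl (@esum_fset _ _ [set` F]); last 2 first.
- exact: finite_seq.
- by move=> x _; case: ifP => // _; rewrite lee_fin.
rewrite -fsbig_seq// -sumEFin; apply: eq_bigr => x _.
case: ifPn; rewrite ?inE ?notin_setE => Sx.
  by case: asboolP => // _; rewrite mul1r.
by case: asboolP => // _; rewrite mul0r.
Qed.

(** A finite F nearly exhausts the sum over D; by nonnegativity it truncates the sum over every
    subset of D with no larger error. One F thus serves all the pieces. *)
Lemma esum_truncate w D (tot eta : R) : (forall x, 0 <= w x) ->
  (\esum_(x in D) (w x)%:E = tot%:E)%E -> 0 < eta ->
  exists F, [/\ uniq F, forall x, x \in F -> D x,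
    (\esum_(x in D `&` ~` [set` F]) (w x)%:E <= eta%:E)%E &
    forall S Y, S `<=` D -> (\esum_(x in S) (w x)%:E = Y%:E)%E ->
      `|\sum_(x <- F) `[< S x >]%:R * w x - Y| <= eta].
Proof.
move=> w0 totE eta0.
have wE S x : S x -> (0 <= (w x)%:E)%E by rewrite lee_fin.
have [|_ [X [finX XD] <-]] := ub_ereal_sup_adherent eta0
  (_ : \esum_(x in D) (w x)%:E \is a fin_num)%E; first by rewrite totE.
rewrite -/(esum D (fun x => (w x)%:E)) totE -EFinB => Xlow.
pose F : seq T := finmap.enum_fset (fset_set X).
have FX : [set` F] = X.
  by apply/seteqP; split => x /=; rewrite /F in_fset_set// inE.
have uF : uniq F by exact: finmap.fset_uniq.
have FD x : x \in F -> D x by move=> xF; apply: XD; rewrite -FX.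
have DX : D `&` X = X by apply/setIidr.
have tail : (\esum_(x in D `&` ~` [set` F]) (w x)%:E <= eta%:E)%E.
  rewrite FX; move: totE; rewrite (esumID X) ?DX//; last exact: wE.
  rewrite (@esum_fset _ _ X)//; last by move=> x _; rewrite lee_fin.
  move: Xlow; set a := (\sum_(_ \in _) _)%E; set b := (\esum_(_ in _) _)%E.
  case: a => [a| |]//; case: b => [b| |]//; rewrite ?lte_fin ?lee_fin => h1 [h2].
  lra.
exists F; split => // S Y SD YE.
have := YE; rewrite (esumID [set` F])//; last exact: wE.
rewrite esum_seq_setI// => YE'.
have : (\esum_(x in S `&` ~` [set` F]) (w x)%:E <= eta%:E)%E.
  apply: le_trans tail; rewrite esum_mkcond [leRHS]esum_mkcond.
  apply: le_esum => x _; case: ifPn => [|_].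
    by rewrite inE => -[Sx nF]; rewrite ifT// inE; split => //; exact: SD.
  by case: ifP => // _; rewrite lee_fin.
have : (0 <= \esum_(x in S `&` ~` [set` F]) (w x)%:E)%E.
  by apply: esum_ge0 => x _; rewrite lee_fin.
move: YE'; set b := (\esum_(_ in _) _)%E; case: b => [b| |]//.
rewrite !lee_fin => -[<-] b0 be.
by rewrite opprD addrA subrr add0r normrN ger0_norm.
Qed.

End truncation.

(** * The good event and the choice of constants *)

Section convergence.
Variables (R : realType) (g : R -> R) (k0 k1 k2 : R).
Hypothesis gk : regular_slope (derI g) (derI (derI g)) k0 k1 k2.
Hypothesis c0 : 0 < c_gamma g.
Local Notation s := (derI g).

Lemma enorm_ge1 (x : direction) : 1 <= enorm R x.
Proof.
rewrite -[leLHS]sqrtr1 ler_sqrt ?addr_ge0 ?sqr_ge0//.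
rewrite -!natrX -natrD ler1n addn_gt0 !expn_gt0 !orbF.
have := @direction_neq0 x; case: (dir1 x) => //= h.
by rewrite lt0n; apply/eqP; exact: h.
Qed.

Lemma len_line_seq (F : seq direction) (nu : config) (t : \bar R) : uniq F ->
  (forall x, x \notin F -> nu x = 0%N) ->
  len_line nu t = \sum_(x <- F | (tau R x <= t)%E) enorm R x * (nu x)%:R.
Proof.
move=> uF nuF; rewrite /len_line -[RHS]big_filter [RHS]fsbig_seq ?filter_uniq//.
apply/esym/fsbig_widen => [x /=|x [/= tx nx]].
  by rewrite mem_filter => /andP[].
rewrite /preimage/= nuF ?mulr0//; apply: contra_notN nx => xF.
by rewrite mem_filter tx.
Qed.

Section good_index.
Variables (M : nat) (n : nat * nat) (Q : probability config R).
Local Notation N := M.+1.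
Local Notation z := (zpow g n).
Local Notation w x := (enorm R x * (z x / (1 - z x))).
Variables (tot V om del Ce : R).
Hypothesis n1 : (0 < n.1)%N.
Hypothesis n2 : (0 < n.2)%N.
Hypothesis Qn : is_Qz g n Q.
Hypothesis om0 : 0 < om.
Hypothesis del0 : 0 < del.
Hypothesis rho1 : `|rho g n - 1| * s 1 < k0 / N%:R.
Hypothesis totE : (\esum_(x in prim (full g n)) (w x)%:E = tot%:E)%E.
Hypothesis meanE : forall j : 'I_N, exists2 Y : R,
  (\esum_(x in prim (piece g M n j)) (w x)%:E = Y%:E)%E &
  `|n.1%:R^-1 * Y - (arclen s (node R M j.+1) - arclen s (node R M j))| <= Ce.
Hypothesis varE : (\esum_(x in prim (full g n))
  (enorm R x ^+ 2 * (z x / (1 - z x) ^+ 2))%:E <= V%:E)%E.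
Hypothesis Vb : n.1%:R^-1 ^+ 2 * V <= del / 2 * om ^+ 2 / N%:R.

(** The bad event is that an edge direction lies outside F, or that in some piece the normalised
    length over F deviates from its mean by at least [om]. The former has probability at most del /
    2, each of the N latter at most del / (2 N); off the bad event the selection bound holds for all
    t at once. *)
Lemma good_index_bound (eps : R) :
  2 * speed s 1 / N%:R + N%:R * (Ce + 2 * om) <= eps ->
  ((1 - del)%:E <= Q [set Gamma | Pi Gamma /\
     (dL (fun t => (n.1%:R^-1 * len_line Gamma t)%R) (len_gamma g)
        <= eps%:E)%E])%E.
Proof.
move=> epsb; have [indep law] := Qn; set A := [set _ | _].
have z01 x : 0 <= z x < 1 := zpow_itv gk c0 x n1 n2.
have m0 x : 0 <= z x / (1 - z x).
  by have /andP[z0 /ltW z1] := z01 x; rewrite divr_ge0// subr_ge0.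
have en0 x : 0 <= enorm R x by rewrite sqrtr_ge0.
have w0 x : 0 <= w x by rewrite mulr_ge0.
have n1R : 1 <= n.1%:R :> R by rewrite ler1n.
have nV0 : 0 <= n.1%:R^-1 :> R by rewrite invr_ge0.
have nV1 : n.1%:R^-1 <= 1 :> R by rewrite invf_le1// (lt_le_trans ltr01).
(* The bound del / 2 is for the probability of edges outside F, the bound [om] for the mean length
   lost in each piece. *)
have eta0 : 0 < Num.min (del / 2) om by rewrite lt_min divr_gt0.
have [F [uF FD tail trunc]] := esum_truncate w0 totE eta0.
pose c (j : nat) x : R := n.1%:R^-1 * (`[< piece g M n j (val x) >]%:R * enorm R x).
have cj0 j x : 0 <= c j x by rewrite !mulr_ge0.
pose Y j (nu : config) := \sum_(x <- F) c j x * (nu x)%:R.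
pose mu j := \sum_(x <- F) c j x * (z x / (1 - z x)).
pose B0 := [set nu : config | exists x, ~ [set` F] x /\ nu x <> 0%N].
pose B (j : nat) := [set nu : config | om <= `|Y j nu - mu j|].
have muE (j : 'I_N) :
    `|mu j - (arclen s (node R M j.+1) - arclen s (node R M j))| <= Ce + om.
  have [Yj YjE Yjb] := meanE j.
  have sub : prim (piece g M n j) `<=` prim (full g n).
    by move=> x; exact: (piece_full gk (ltn_ord j)).
  have := trunc _ _ sub YjE => tr.
  have muE' : mu j = n.1%:R^-1 * \sum_(x <- F) `[< prim (piece g M n j) x >]%:R * w x.
    by rewrite mulr_sumr; apply: eq_bigr => x _; rewrite /c /prim/=; ring.
  have {}tr : `|mu j - n.1%:R^-1 * Yj| <= om.
    rewrite muE' -mulrBr normrM (ger0_norm nV0).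
    apply: (@le_trans _ _ (1 * om)); last by rewrite mul1r.
    by apply: ler_pM => //; apply: le_trans tr _; rewrite ge_min lexx orbT.
  rewrite -(subrKA (n.1%:R^-1 * Yj)) [leRHS]addrC.
  exact: le_trans (ler_normD _ _) (lerD tr Yjb).
have good nu : ~ B0 nu -> (forall j : 'I_N, ~ B j nu) -> A nu.
  move=> nB0 nB.
  have nuF x : x \notin F -> nu x = 0%N.
    move=> xF; apply/eqP; apply: contraPT isT => nx _; apply: nB0.
    by exists x; split; [exact/negP|exact/eqP].
  split.
    apply: (sub_finite_set _ (finite_seq F)) => x /= nx.
    by apply: contraT => /nuF e; rewrite e eqxx in nx.
  apply: ge_ereal_sup => _ [t t0 <-]; rewrite lee_fin (len_line_seq _ uF nuF).
  apply: le_trans epsb; rewrite mulr_sumr.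
  apply: (select_bound gk c0 n1 n2 rho1 t0 (F := F)
    (f := fun x => n.1%:R^-1 * (enorm R x * (nu x)%:R))).
  - by move=> x /FD.
  - by move=> x; rewrite !mulr_ge0.
  - have [Y0 _ /(le_trans (normr_ge0 _)) Ce0] := meanE ord0.
    by rewrite addr_ge0// mulr_ge0// ltW.
  - move=> j jN; pose j' := Ordinal jN.
    have -> : \sum_(x <- F) `[< piece g M n j (val x) >]%:R *
        (n.1%:R^-1 * (enorm R x * (nu x)%:R)) = Y j nu.
      by apply: eq_bigr => x _; rewrite /c; ring.
    have /negP := nB j'; rewrite /B /= -ltNge => /ltW h1.
    have h2 := muE j'.
    rewrite -(subrKA (mu j)); apply: le_trans (ler_normD _ _) _.
    apply: le_trans (lerD h1 h2) _.
    by rewrite addrCA mulr_natl mulr2n.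
have mA : measurable A by apply: measurable_sub_Pi => nu [].
have [mB0 QB0] := off_support law [set` F].
have mB j : measurable (B j).
  have mY : measurable_fun setT (fun nu : config => `|Y j nu - mu j|).
    apply: measurableT_comp => //; apply: measurable_funB => //.
    by apply: measurable_sum => x; exact: (measurable_fun_coord x (fun k => c j x * k%:R)).
  have := mY measurableT `[om, +oo[%classic (measurable_itv _).
  rewrite setTI; congr measurable; apply/seteqP.
  by split => nu; rewrite /B /= in_itv/= andbT.
have QB0le : (Q B0 <= (del / 2)%:E)%E.
  apply: le_trans QB0 _; apply: (@le_trans _ _
    (\esum_(x in prim (full g n) `&` ~` [set` F]) (w x)%:E)%E); last first.
    by apply: le_trans tail _; rewrite lee_fin ge_min lexx.
  rewrite esum_mkcond [leRHS]esum_mkcond; apply: le_esum => x _.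
  case: ifPn => [xF|_]; last by case: ifP => // _; rewrite lee_fin.
  (* Inside the cone |x| >= 1 and 1 / (1 - z x) >= 1, so z x is at most the mean length contributed
     by x; outside the cone z x = 0. *)
  case: ifPn; rewrite lee_fin; rewrite inE in xF; rewrite ?inE ?notin_setE => h.
    have /andP[z0 z1] := z01 x.
    apply: (@le_trans _ _ (1 * (z x / (1 - z x)))).
      by rewrite mul1r ler_pdivlMr ?subr_gt0// ler_piMr// gerBl.
    by rewrite ler_wpM2r// enorm_ge1.
  by rewrite (zpow_out c0 n1 n2)// => xS; apply: h; split.
have QB j : (Q (B j) <= (del / 2 / N%:R)%:E)%E.
  apply: le_trans (chebyshev_sum z01 indep law uF (cj0 j) om0) _.
  rewrite lee_fin ler_pdivrMr ?exprn_gt0//.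
  rewrite [leRHS]mulrAC; apply: le_trans Vb.
  have var0 x : 0 <= z x / (1 - z x) ^+ 2.
    by have /andP[z0 _] := z01 x; rewrite divr_ge0// sqr_ge0.
  apply: (@le_trans _ _ (n.1%:R^-1 ^+ 2 *
      \sum_(x <- F) enorm R x ^+ 2 * (z x / (1 - z x) ^+ 2))).
    rewrite mulr_sumr; apply: ler_sum => x _; rewrite /c.
    case: asboolP => _; first by rewrite mul1r exprMn [leRHS]mulrA.
    by rewrite mul0r mulr0 expr0n mul0r mulr_ge0 ?sqr_ge0// mulr_ge0 ?sqr_ge0.
  rewrite ler_wpM2l ?sqr_ge0// -lee_fin; apply: le_trans varE.
  apply: esum_ge; exists [set` F]; first by split; [exact: finite_seq|].
  by rewrite -fsbig_seq// sumEFin.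
have QC : (Q (~` A) <= del%:E)%E.
  pose U := \big[setU/set0]_(j < N) B j.
  have mU : measurable U by apply: bigsetU_measurable => j _; exact: mB.
  apply: (@le_trans _ _ (Q (B0 `|` U))).
    apply: le_measure; rewrite ?inE; [exact: measurableC|exact: measurableU|].
    move=> nu nA; apply: contrapT => h; apply: nA; apply: good => [b|j b].
      by apply: h; left.
    by apply: h; right; rewrite /U -(bigcup_mkord N B); exists j => //=.
  apply: le_trans (measureU2 _ mB0 mU) _.
  have -> : del%:E = ((del / 2)%:E + (del / 2)%:E)%E :> \bar R.
    by rewrite -EFinD; congr EFin; field.
  apply: leeD => //; apply: le_trans (Boole_inequality _ _) _ => //.
  apply: (@le_trans _ _ (\sum_(j < N) (del / 2 / N%:R)%:E)%E).
    by apply: lee_sum => j _; exact: QB.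
  by rewrite sumEFin lee_fin sumr_const card_ord -[leLHS]mulr_natr divfK ?pnatr_eq0.
have : (Q (~` A) = 1 - Q A)%E by rewrite probability_setC.
have QA1 : (Q A <= 1)%E by exact: probability_le1.
have QA0 : (0 <= Q A)%E by exact: measure_ge0.
move: QC QA1 QA0; case: (Q A) => [q| |]// + _ _ e.
rewrite e -EFinB !lee_fin; lra.
Qed.

End good_index.

Lemma mesh_const_ge0 : 0 <= mesh_const g k0 k1 k2.
Proof.
have k00 := rs_k0 gk.
have /andP[h1 h2] := rs_bound gk (introT andP (conj (lexx 0) ler01)).
apply: addr_ge0; first exact: le_trans (ltW k00) (le_trans h1 h2).
apply: divr_ge0; last exact: ltW.
apply: mulr_ge0; last exact: sqrtr_ge0.
by apply: mulr_ge0 => //; exact: (rs_k2 gk).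
Qed.

Lemma line_converges (Q : nat * nat -> probability config R) (eps del : R) :
  (forall n, (1 <= n.1)%N -> (1 <= n.2)%N -> is_Qz g n (Q n)) ->
  0 < eps -> 0 < del ->
  \forall n \near n_infty (c_gamma g),
    ((1 - del)%:E <= Q n [set Gamma | Pi Gamma /\
       (dL (fun t => (n.1%:R^-1 * len_line Gamma t)%R) (len_gamma g)
          <= eps%:E)%E])%E.
Proof.
move=> Qlaw eps0 del0; set C := mesh_const g k0 k1 k2.
have C0 : 0 <= C := mesh_const_ge0.
have B0 : 0 <= 2 * speed s 1 + C by rewrite addr_ge0// mulr_ge0// sqrtr_ge0.
have e20 : 0 < eps / 2 by rewrite divr_gt0.
(* N is fixed by the errors that do not vanish with n: 2 speed(1) / N from the unresolved pieces
   near the cut and C / N from the mesh. *)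
have [[//|M] _ Nb] := small_inv B0 e20.
have NR : 0 < M.+1%:R :> R by rewrite ltr0n.
(* Each piece costs 3 om: once for its mean inside Ce, once for the truncation to F, once for the
   deviation. In total 3 N om = eps / 2. *)
pose om := eps / 2 / (3 * M.+1%:R).
have om0 : 0 < om by rewrite !divr_gt0// mulr_gt0.
pose Ce := C * (M.+1%:R^-1) ^+ 2 + om.
have s10 : 0 <= s 1 by apply: (slope_nonneg gk); rewrite ler01 lexx.
have d0 : 0 < k0 / M.+1%:R / (s 1 + 1).
  by rewrite !divr_gt0 ?(rs_k0 gk)// ltr_wpDl.
have V0 : 0 < del / 2 * om ^+ 2 / M.+1%:R by rewrite !mulr_gt0 ?invr_gt0 ?exprn_gt0.
have mean : \forall n \near n_infty (c_gamma g), forall j : 'I_M.+1, exists2 Y : R,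
    (\esum_(x in prim (piece g M n j))
       (enorm R x * (zpow g n x / (1 - zpow g n x)))%:E = Y%:E)%E &
    `|n.1%:R^-1 * Y - (arclen s (node R M j.+1) - arclen s (node R M j))| <= Ce.
  apply: filter_forall => j; rewrite /Ce -(nodeS R M j).
  apply: (cone_mean gk c0) => //; first exact: node_ge0.
    by rewrite node_le.
  by rewrite node_le1.
near=> n.
have [_ [n1 n2]] : (0 <= n.1%:R :> R) /\ (0 < n.1)%N /\ (0 < n.2)%N.
  by near: n; exact: n_infty_ge.
have rho1 : `|rho g n - 1| <= k0 / M.+1%:R / (s 1 + 1).
  by near: n; exact: (rho_near c0 d0).
have [tot totE _] : exists2 Y : R,
    (\esum_(x in prim (cone (rho g n) (s 0) (s 1) true))
       (enorm R x * (zpow g n x / (1 - zpow g n x)))%:E = Y%:E)%E &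
    `|n.1%:R^-1 * Y - (arclen s 1 - arclen s 0)| <= C * (1 - 0) ^+ 2 + om.
  by near: n; exact: (cone_mean gk c0 true (lexx 0) ler01 (lexx 1) om0).
have [V VE Vb] : exists2 V : R,
    (\esum_(x in prim (cone (rho g n) (s 0) (s 1) true))
       (enorm R x ^+ 2 * (zpow g n x / (1 - zpow g n x) ^+ 2))%:E <= V%:E)%E &
    n.1%:R^-1 ^+ 2 * V <= del / 2 * om ^+ 2 / M.+1%:R.
  by near: n; exact: (cone_variance gk c0 V0).
apply: (good_index_bound (M := M) (Ce := Ce) (om := om) n1 n2 (Qlaw n n1 n2)
  om0 del0 _ totE _ VE Vb).
- rewrite ler_pdivlMr ?ltr_wpDl// mulrDr mulr1 in rho1.
  (* The extra summand |rho - 1| makes the inequality strict unless it vanishes, and then k0 > 0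
     does. *)
  have [->|r0] := eqVneq (`|rho g n - 1|) 0.
    by rewrite mul0r divr_gt0// (rs_k0 gk).
  apply: lt_le_trans rho1; rewrite ltrDl lt_neqAle eq_sym r0 //=.
- by near: n.
- have -> : M.+1%:R * (Ce + 2 * om) = C / M.+1%:R + eps / 2.
    by rewrite /Ce /om; field; rewrite lt0r_neq0.
  rewrite addrA -mulrDl; apply: le_trans (lerD Nb (lexx _)) _.
  by rewrite -splitr.
Unshelve. all: by end_near. Qed.

End convergence.

Theorem theorem8p1 (R : realType) (g : R -> R)
    (g_C3 : CkI 3 g)
    (g_incr : strictly_increasingI g)
    (g_conv : strictly_convexI g)
    (g_0 : g 0 = 0)
    (g_curv : curvature_bounded_below g)
    (Q : nat * nat -> probability config R)
    (Q_law : forall n : nat * nat,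
       (1 <= n.1)%N -> (1 <= n.2)%N -> is_Qz g n (Q n))
    (eps : R) (eps_gt0 : 0 < eps) :
  Q n [set Gamma | Pi Gamma /\
         (dL (fun t => (n.1%:R^-1 * len_line Gamma t)%R) (len_gamma g)
            <= eps%:E)%E]
    @[n --> n_infty (c_gamma g)] --> 1%E.
Proof.
have [k0 [k1 [k2 gk]]] := regular_slope_derI g_C3 g_incr g_curv.
have c0 : 0 < c_gamma g.
  by rewrite /c_gamma -g_0; apply: g_incr; rewrite ?in_itv/= ?lexx ?ler01.
apply/fine_cvgP; split.
  by apply: nearW => n; apply: fin_num_measure; apply: measurable_sub_Pi => nu [].
apply/cvgrPdist_le => del del0.
(* Probabilities are at most 1, so the lower bound 1 - del is all that convergence to 1 requires. *)
have := line_converges gk c0 Q_law eps_gt0 del0; apply: filterS => n /=.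
set A := [set Gamma | _].
have : (Q n A <= 1)%E.
  by apply: probability_le1; apply: measurable_sub_Pi => nu [].
have : (0 <= Q n A)%E by exact: measure_ge0.
case: (Q n A) => [q| |]//; rewrite !lee_fin /= => q0 q1 dq.
by rewrite ger0_norm ?subr_ge0// lerBlDr addrC -lerBlDr.
Qed.
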